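(* Suppose that $f$ is $L$-smooth relative to $h$ and (SDA) is run with $y_1=0$ and learning rate $\eta_t=\beta/t^{1/p}$, $0<\beta\le1/(pL)$. Then the time-averaged iterate $\bar x_T=\frac1T\sum_{t=1}^Tx_t$ satisfies $$\mathbb E[f(\bar x_T)]\le\min f+\frac{f(x_1)-\min f}{T}+\frac{H+\beta^pV_\sigma^p}{\beta\,T^{(p-1)/p}}.$$ In particular, for $\beta=[H/(p-1)]^{1/p}/V_\sigma$ (assuming this value is admissible, i.e. at most $1/(pL)$), $$\mathbb E[f(\bar x_T)]\le\min f+\frac{f(x_1)-\min f}{T}+\frac{p\,[H/(p-1)]^{(p-1)/p}\,V_\sigma}{T^{(p-1)/p}}.$$
   Context: Optimization setup. $\mathcal V$ is a real $n$-dimensional normed space with norm $\|\cdot\|$; $\mathcal Y=\mathcal V^*$ is its dual, with pairing $\langle y,x\rangle$ and dual norm $\|y\|_*=\sup\{\langle y,x\rangle:\|x\|\le1\}$. $\mathcal X\subset\mathcal V$ is a nonempty compact convex set with diameter $\|\mathcal X\|=\max_{x,x'\in\mathcal X}\|x'-x\|$. The objective $f:\mathcal V\to\mathbb R\cup\{\infty\}$ is convex, finite and continuous on $\mathcal X$, and $\partial f$ admits a continuous selection $\nabla f(x)\in\partial f(x)$ on $\operatorname{dom}\partial f=\{x:\partial f(x)\ne\varnothing\}$. $\min f$ is taken over $\mathcal X$. Mirror setup. $h:\mathcal V\to\mathbb R\cup\{\infty\}$ is convex with $\operatorname{dom}h=\mathcal X$, continuous on $\mathcal X$; $\mathcal X_h=\operatorname{dom}\partial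 h$; $\partial h$ admits a continuous selection $\nabla h$ on $\mathcal X_h$; and for some $K>0$, $h(x')\ge h(x)+\langle\nabla h(x),x'-x\rangle+\frac K2\|x'-x\|^2$ for all $x\in\mathcal X_h$, $x'\in\mathcal X$. It is assumed that $\nabla f$ is defined on $\mathcal X_h$. $D(x',x)=h(x')-h(x)-\langle\nabla h(x),x'-x\rangle$ is the Bregman divergence, $Q(y)=\operatorname{argmax}_{x\in\mathcal X}\{\langle y,x\rangle-h(x)\}$ the mirror map, and $H=\max_{\mathcal X}h-\min_{\mathcal X}h$. $f$ is $L$-smooth relative to $h$ if $f(x')\le f(x)+\langle\nabla f(x),x'-x\rangle+L\,D(x',x)$ for all $x\in\mathcal X_h$, $x'\in\mathcal X$. Algorithm. (SDA): $y_{t+1}=y_t-g_t$, $x_{t+1}=Q(\eta_{t+1}y_{t+1})$, $t=1,2,\dots$, with $x_1=Q(\eta_1y_1)$ and stochastic gradients $g_t=\nabla f(x_t)+U_t$, $U_t=U(x_t;\omega_t)$, where $\omega_1,\omega_2,\dots$ are i.i.d. random seeds and, for all $x\in\operatorname{dom}\partial f$, $\mathbb E[U(x;\omega)]=0$ and $\mathbb E[\|U(x;\omega)\|_*^p]\le\sigma^p$ for some $p\in(1,2]$. Noise constant: $V_\sigma^p=\|\mathcal X\|^{2-p}(2/K)^{p-1}\sigma^p$. *)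

(* Defs.v *)
From HB Require Import structures.
From mathcomp Require Import all_boot all_order all_algebra.
From mathcomp Require Import all_classical all_reals all_analysis.
Set Implicit Arguments.
Unset Strict Implicit.
Unset Printing Implicit Defensive.
Import Order.TTheory GRing.Theory Num.Theory.
Import numFieldNormedType.Exports.
Local Open Scope classical_set_scope.
Local Open Scope ring_scope.
Local Open Scope ereal_scope.

(* Finite-dimensional normed spaces.  Every linear form on such a space is
   continuous, so 'Hom(V, R^o) is the full topological dual. *)
#[short(type="normedVectType")]
HB.structure Definition NormedVector (R : numFieldType) :=
  {V of NormedModule R V & Vector R V}.

Section convex_analysis.
Context {R : realType} {V : normedVectType R}.
Implicit Types (X D : set V) (f h : V -> \bar R) (x v : V).
Local Notation V' := 'Hom(V, R^o).
Implicit Types (y : V') (g gradf gradh : V -> V').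

Definition dual_norm y : R := sup [set (y v : R) | v in [set v | (`|v| <= 1)%R]].

Definition diameter X : R :=
  sup [set r : R | exists x x', [/\ X x, X x' & r = `|x' - x|%R]].

(* The values of f are in R \cup {+oo}. *)
Definition convex_ext f :=
  (forall x, f x != -oo) /\
  forall x x' (t : R), (0 < t < 1)%R ->
    f (t *: x + (1 - t) *: x')%R <= t%:E * f x + (1 - t)%:E * f x'.

Definition subdiff f x : set V' :=
  [set y | forall x', f x + (y (x' - x)%R)%:E <= f x'].

Definition dom_subdiff f : set V := [set x | subdiff f x !=set0].

(* Continuity on D is for the dual norm on the target. *)
Definition continuous_selection f g :=
  let D := dom_subdiff f in
  (forall x, D x -> subdiff f x (g x)) /\
  (forall x, D x ->
    dual_norm (g z - g x)%R @[z --> within D (nbhs x)] --> (0 : R)%R).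

Definition bregman h g x' x : \bar R := h x' - h x - (g x (x' - x)%R)%:E.

Definition strongly_convex h g (K : R) X :=
  forall x x', dom_subdiff h x -> X x' ->
    h x + (g x (x' - x)%R)%:E + (K / 2 * `|x' - x| ^+ 2)%:E <= h x'.

Definition relatively_smooth f gradf h gradh (L : R) X :=
  forall x x', dom_subdiff h x -> X x' ->
    f x' <= f x + (gradf x (x' - x)%R)%:E + L%:E * bregman h gradh x' x.

(* For h continuous and strongly convex on X compact, the set of maximizers is
   a singleton, so [get] selects its unique element. *)
Definition mirror_map X h y : V :=
  get [set x | X x /\
    forall x', X x' -> (y x')%:E - h x' <= (y x)%:E - h x].

Definition min_over X f : \bar R := ereal_inf (f @` X).

(* max h - min h over X; both are attained and finite for h finite and
   continuous on X nonempty and compact. *)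
Definition range_width X h : R := fine (ereal_sup (h @` X) - ereal_inf (h @` X)).

Definition noise_const X (K p sigma : R) : R :=
  ((diameter X `^ (2 - p) * (2 / K) `^ (p - 1) * sigma `^ p) `^ p^-1)%R.

End convex_analysis.

(* Measurability for the trace sigma-algebra on D, which need not itself be
   measurable. *)
Definition measurable_on d d' (T : measurableType d) (T' : measurableType d')
    (D : set T) (F : T -> T') :=
  forall B, measurable B ->
    exists2 C, measurable C & D `&` F @^-1` B = D `&` C.

Definition borel_type (T : ptopologicalType) := g_sigma_algebraType (@open T).

Section stochastic.
Context {R : realType} {V : normedVectType R}.
Local Notation V' := 'Hom(V, R^o).
Context {dS : measure_display} {S : measurableType dS}.

(* Joint measurability on dom \partial f x S; since V' is finite-dimensional,
   its Borel sigma-algebra is the one generated by the evaluations y |-> y v,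
   and expectations in V' are computed evaluation by evaluation. *)
Definition stochastic_noise (f : V -> \bar R) (mu : probability S R)
    (U : V -> S -> V') (p sigma : R) :=
  [/\ forall v, measurable_on
        [set z : borel_type V * S | dom_subdiff f z.1]
        (fun z => U z.1 z.2 v : R),
      forall x v, dom_subdiff f x -> 'E_mu[fun s => U x s v : R] = 0 &
      forall x, dom_subdiff f x ->
        'E_mu[fun s => (dual_norm (U x s) `^ p)%R] <= (sigma `^ p)%:E].

(* Indices start at 1: omega 0 is unconstrained. *)
Definition iid_seeds dO (Omega : measurableType dO) (P : probability Omega R)
    (mu : probability S R) (omega : nat -> {RV P >-> S}) :=
  (forall t A, (0 < t)%N -> measurable A -> P (omega t @^-1` A) = mu A) /\
  (forall (I : seq nat) (A : nat -> set S),
     uniq I -> {in I, forall t, (0 < t)%N} -> (forall t, measurable (A t)) ->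
     P (\bigcap_(t in [set` I]) omega t @^-1` A t) =
     \prod_(t <- I) P (omega t @^-1` A t)).

(* Indices start at 1: x 0 and y 0 are unconstrained. *)
Definition SDA (X : set V) (h : V -> \bar R) (gradf : V -> V')
    (U : V -> S -> V') (Omega : Type) (omega : nat -> Omega -> S)
    (eta : nat -> R) (y1 : V')
    (x : nat -> Omega -> V) (y : nat -> Omega -> V') :=
  forall w,
  [/\ y 1%N w = y1,
      forall t, (0 < t)%N -> x t w = mirror_map X h (eta t *: y t w)%R &
      forall t, (0 < t)%N ->
        y t.+1 w = (y t w - (gradf (x t w) + U (x t w) (omega t w)))%R].

Definition time_average (Omega : Type) (x : nat -> Omega -> V) (T : nat)
    (w : Omega) : V := (T%:R^-1 *: \sum_(1 <= t < T.+1) x t w)%R.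

End stochastic.

(* Main.v *)
(* Dual averaging is analysed with the potential
     max_x (<y_t, x> - (h x - min h) / eta_t) - <y_t, z>,
   for a minimizer z of f.  It decreases by at least <g_t, x_{t+1} - z> + F_t
   / eta_t at each step, where F_t is the Fenchel coupling of x_{t+1} and
   eta_t y_t, and F_t dominates both the Bregman divergence D(x_{t+1}, x_t)
   and (K/2) |x_{t+1} - x_t|^2.  Relative smoothness bounds f(x_{t+1}) - f(z)
   by the gradient part plus L F_t; as L <= 1 / (p eta_t), a share (p-1)/p of
   F_t / eta_t is left to absorb <U_t, x_{t+1} - x_t>.  Young's inequality,
   together with |x_{t+1} - x_t| <= diam X, leaves a remainder of order
   eta_t^(p-1) |U_t|^p. The other noise term <U_t, x_t - z> has mean zero
   because x_t is a measurable function of the seeds before omega_t.  The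
   comparison of F_t with D uses that the continuous selection of the
   subdifferential of h dominates every subgradient in feasible directions,
   which follows from monotonicity and the density of the domain of the
   subdifferential in X. *)
Require Import Defs.
From HB Require Import structures.
From mathcomp Require Import all_boot all_order all_algebra.
From mathcomp Require Import all_classical all_reals all_analysis.
From mathcomp Require Import measurable_realfun.
From mathcomp Require Import ring lra.
Import Order.TTheory GRing.Theory Num.Theory.
Import numFieldNormedType.Exports.
Local Open Scope classical_set_scope.
Local Open Scope ring_scope.

(** * Real inequalities *)

Section real_inequalities.
Context {R : realType}.
Implicit Types a b d s t u r p D K eta : R.

(** Young's inequality with conjugate exponents [1/t] and [1/(1-t)], applied to [a^t] and
    [b^(1-t)]. *)
Lemma weighted_amgm a b t : 0 <= a -> 0 <= b -> 0 < t < 1 ->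
  a `^ t * b `^ (1 - t) <= t * a + (1 - t) * b.
Proof.
move=> a0 b0 /andP[t0 t1]; have u0 : 0 < 1 - t by rewrite subr_gt0.
have := @conjugate_powR R (a `^ t) (b `^ (1 - t)) t^-1 (1 - t)^-1
  (powR_ge0 _ _) (powR_ge0 _ _).
rewrite !invr_gt0 !invrK => /(_ t0 u0 (subrKC _ _)).
by rewrite -!powRrM !divff ?gt_eqF// !powRr1// ![_ * t]mulrC ![_ * (1 - t)]mulrC.
Qed.

(** A discrete form of integrating [t^(r-1)]. With [m = n+1], the induction step asks for
    [r m^(r-1) <= m^r - n^r], which is weighted AM-GM for [n] and [m] multiplied by [m^(r-1)]. *)
Lemma sum_powRB1_le r n : 0 < r < 1 ->
  \sum_(1 <= t < n.+1) (t%:R : R) `^ (r - 1) <= r^-1 * n%:R `^ r.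
Proof.
move=> r01; have /andP[r0 r1] := r01.
elim: n => [|n IH]; first by rewrite big_nil mulr_ge0 ?powR_ge0// invr_ge0 ltW.
rewrite big_nat_recr//= -lerBrDr (le_trans IH)// lerBrDr.
rewrite -(ler_pM2l r0) mulrDr !mulVKf ?gt_eqF//.
set m : R := n.+1%:R.
have m0 : 0 < m by rewrite ltr0n.
have /(ler_wpM2r (powR_ge0 m (r - 1))) :=
  @weighted_amgm n%:R m r (ler0n _ _) (ltW m0) r01.
rewrite -mulrA -powRD ?(gt_eqF m0) ?implybT//.
rewrite [1 - r + _]addrC subrKA subrr powRr0 mulr1.
rewrite [X in _ <= X * _](_ : _ = m - r); last first.
  by rewrite /m -natr1; ring.
by rewrite mulrBl mulr_powRB1 ?(ltW m0)// lerBrDr.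
Qed.

(* Young's inequality applied to [s d^((2-p)/p)] and [d^(2(p-1)/p)]. *)
Lemma young_diameter p s d D : 1 < p <= 2 -> 0 <= s -> 0 <= d <= D ->
  s * d <= p^-1 * s `^ p * D `^ (2 - p) + (p - 1) / p * d ^+ 2.
Proof.
move=> /andP[p1 p2] s0 /andP[d0 dD].
have p0 : 0 < p by rewrite (lt_trans ltr01).
have pn0 : p != 0 by rewrite gt_eqF.
have [->|dn0] := eqVneq d 0.
  rewrite mulr0 expr0n/= mulr0 addr0 mulr_ge0 ?powR_ge0// mulr_ge0 ?powR_ge0//.
  by rewrite invr_ge0 ltW.
have d_gt0 : 0 < d by rewrite lt_neqAle eq_sym dn0.
have t01 : 0 < p^-1 < 1 by rewrite invr_gt0 p0 invf_lt1.
have := @weighted_amgm (s `^ p * d `^ (2 - p)) (d ^+ 2) p^-1.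
rewrite mulr_ge0 ?powR_ge0// exprn_ge0// => /(_ isT isT t01).
rewrite powRM ?powR_ge0// -!powRrM divff// powRr1// -powR_mulrn// -powRrM.
rewrite -mulrA -powRD ?dn0 ?implybT//.
rewrite (_ : (2 - p) / p + 2 * (1 - p^-1) = 1); last by field.
rewrite powRr1// => /le_trans; apply.
rewrite powR_mulrn// mulrA [(p - 1) / p]mulrBl divff// mul1r lerD//.
rewrite ler_wpM2l ?mulr_ge0 ?powR_ge0 ?invr_ge0 ?(ltW p0)//.
by rewrite ge0_ler_powR ?nnegrE ?subr_ge0// (le_trans d0).
Qed.

(** [young_diameter] with [s = u x] and [x = 2 eta / K], divided by [x]: this scaling gives the
    quadratic term the factor [K / (2 eta)] that the Fenchel coupling can absorb. *)
Lemma noise_vs_quadratic p K eta u d D : 1 < p <= 2 -> 0 < K -> 0 < eta ->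
  0 <= u -> 0 <= d <= D ->
  u * d <= (p - 1) / p / eta * (K / 2 * d ^+ 2) +
    p^-1 * (D `^ (2 - p) * (2 / K) `^ (p - 1) * u `^ p) * eta `^ (p - 1).
Proof.
move=> p12 K0 e0 u0 dD; set x := 2 / K * eta.
have /andP[p1 _] := p12; have p0 : 0 < p by rewrite (lt_trans ltr01).
have x0 : 0 < x by rewrite mulr_gt0// divr_gt0.
have := @young_diameter p (u * x) d D p12 (mulr_ge0 u0 (ltW x0)) dD.
rewrite -(ler_pM2l (_ : 0 < x^-1)) ?invr_gt0// => H.
rewrite [leLHS](_ : _ = x^-1 * (u * x * d)); last by field; rewrite gt_eqF.
apply: (le_trans H); rewrite powRM ?(ltW x0)// -(@mulr_powRB1 _ x p) ?(ltW x0)//.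
rewrite {3}/x powRM ?(ltW e0) ?divr_ge0 ?(ltW K0)//.
rewrite le_eqVlt; apply/orP; left; apply/eqP.
set a := D `^ _; set b := (2 / K) `^ _; set c := u `^ _; set e := eta `^ _.
by rewrite /x; field; rewrite !gt_eqF.
Qed.

End real_inequalities.

(** * Linear forms and measurability on a finite-dimensional normed space *)

Section finite_dimensional.
Context {R : realType} {V : normedVectType R}.
Local Notation V' := 'Hom(V, R^o).
Local Notation n := (\dim {:V}).
Local Notation e := (vbasis {:V}).
Implicit Types (y z : V') (v x : V) (r : 'rV[R]_n).

Lemma sum_coord_vbasis v : v = \sum_i coord e i v *: e`_i.
Proof. exact/coord_vbasis/memvf. Qed.

Definition vec_of_row r : V := \sum_i r 0 i *: e`_i.

Lemma coord_vec_of_row r i : coord e i (vec_of_row r) = r 0 i.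
Proof. by rewrite coord_sum_free// (basis_free (vbasisP _)). Qed.

Lemma vec_of_row_coord v : vec_of_row (\row_i coord e i v) = v.
Proof. by rewrite [RHS]sum_coord_vbasis; apply: eq_bigr => i _; rewrite mxE. Qed.

Lemma vec_of_row_continuous : continuous vec_of_row.
Proof.
suff H (r : 'rV[R]_n) : vec_of_row s @[s --> r] --> vec_of_row r by move=> r; exact: H.
rewrite /vec_of_row; elim: (index_enum _) => [|i s IH].
  rewrite big_nil (_ : (fun _ => _) = cst 0); last first.
    by apply/funext => s; rewrite big_nil.
  exact: (cvg_cst _ (FF := nbhs_filter r)).
rewrite big_cons; under eq_fun do rewrite big_cons.
apply: (cvgD (FF := nbhs_filter r) _ IH).
exact: (cvgZr_tmp (FF := nbhs_filter r) (@coord_continuous _ _ _ 0 i r)).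
Qed.

(** Equivalence of norms: on the compact unit sphere of rows for the sup norm, the norm of
    [vec_of_row] attains a minimum, positive because the basis is free; homogeneity does the
    rest. *)
Lemma coord_bound :
  exists2 C : R, 0 < C & forall i v, `|coord e i v| <= C * `|v|.
Proof.
(* In dimension zero the sphere below is empty, but there is no index [i] either. *)
have [n0|n0] := posnP n.
  exists 1 => // i; exfalso; by have := ltn_ord i; rewrite {2}n0.
pose S := [set r : 'rV[R]_n | `|r| = 1].
have compS : compact S.
  apply: bounded_closed_compact.
    by exists 1; split => // M M1 r /= ->; exact: ltW.
  apply: (@preimage_closed _ _ (fun r : 'rV[R]_n => `|r|) [set 1%R]).
    by move=> r _; exact: norm_continuous.
  exact: closed_eq.
have S0 : S !=set0.
  pose u : 'rV[R]_n := const_mx 1.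
  have u0 : u != 0.
    apply/eqP => /matrixP/(_ 0 (Ordinal n0)); rewrite !mxE => /eqP.
    by rewrite oner_eq0.
  by exists (`|u|^-1 *: u); rewrite /S/= normrZ normfV normr_id mulVf ?normr_eq0.
have [r0 r0S Hr0] : exists2 r0, r0 \in S &
    forall r, r \in S -> `|vec_of_row r0| <= `|vec_of_row r|.
  apply: compact_EVT_min => //; apply: continuous_subspaceT => r.
  apply: (@continuous_comp _ _ _ vec_of_row Num.norm).
    exact: vec_of_row_continuous.
  exact: norm_continuous.
have m0 : 0 < `|vec_of_row r0|.
  rewrite normr_gt0; apply/eqP => H.
  have r00 : r0 = 0.
    by apply/rowP => i; rewrite -coord_vec_of_row H linear0 mxE.
  by move: r0S; rewrite inE /S/= r00 normr0 => /eqP; rewrite eq_sym oner_eq0.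
exists `|vec_of_row r0|^-1; first by rewrite invr_gt0.
move=> i v; rewrite ler_pdivlMl//.
pose r := \row_i coord e i v.
have ri : `|coord e i v| <= `|r|.
  rewrite [leRHS]/Num.norm/= mx_normrE; apply/bigmax_geP; right => /=.
  by exists (0, i) => //=; rewrite mxE.
apply: (@le_trans _ _ (`|vec_of_row r0| * `|r|)); first by rewrite ler_pM2l.
have [->|rn0] := eqVneq r 0; first by rewrite normr0 mulr0.
have := Hr0 (`|r|^-1 *: r).
rewrite inE /S/= normrZ normfV normr_id mulVf ?normr_eq0// => /(_ erefl).
have -> : vec_of_row (`|r|^-1 *: r) = `|r|^-1 *: v.
  rewrite -[in RHS](vec_of_row_coord v) /vec_of_row scaler_sumr.
  by apply: eq_bigr => j _; rewrite mxE scalerA.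
by rewrite normrZ normfV normr_id ler_pdivlMl ?normr_gt0// mulrC.
Qed.

Lemma form_bound y : exists2 M : R, 0 <= M & forall v, `|y v| <= M * `|v|.
Proof.
have [C C0 HC] := coord_bound.
exists (\sum_(i < n) C * `|y e`_i|).
  by apply: sumr_ge0 => i _; rewrite mulr_ge0// ltW.
move=> v; rewrite [in y v](sum_coord_vbasis v) linear_sum.
apply: (le_trans (ler_norm_sum _ _ _)).
rewrite mulr_suml ler_sum// => i _.
rewrite linearZ/= [_ *: _]/(_ * _) normrM mulrAC ler_wpM2r//; exact: HC.
Qed.

Lemma form_continuous y : continuous (y : V -> R^o).
Proof.
have [M M0 HM] := form_bound y.
apply: (@bounded_linear_continuous _ V R^o y).
apply/linear_boundedP; near=> r => v.
by rewrite (le_trans (HM v))// ler_wpM2r.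
Unshelve. all: end_near. Qed.

Lemma coord_vbasis_continuous i : continuous (coord e i : V -> R^o).
Proof.
have := form_continuous (linfun (coord e i : V -> R^o)).
by rewrite (_ : (linfun _ : V -> R^o) = coord e i)//; apply/funext => v; rewrite lfunE.
Qed.

Lemma has_sup_dual_norm y :
  has_sup [set (y v : R) | v in [set v : V | `|v| <= 1]].
Proof.
have [M M0 HM] := form_bound y; split.
  by exists (y 0); exists 0 => //=; rewrite normr0.
exists M => _ [v /= v1 <-]; apply: (le_trans (ler_norm _)).
by rewrite (le_trans (HM v))// ler_piMr.
Qed.

Lemma dual_norm_ge0 y : 0 <= dual_norm y.
Proof.
apply: ub_le_sup; first by have [] := has_sup_dual_norm y.
by exists 0; rewrite ?linear0//= normr0.
Qed.

Lemma le_dual_norm y v : y v <= dual_norm y * `|v|.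
Proof.
have [->|v0] := eqVneq v 0; first by rewrite linear0 normr0 mulr0.
rewrite -ler_pdivrMr ?normr_gt0// mulrC.
apply: ub_le_sup; first by have [] := has_sup_dual_norm y.
by exists (`|v|^-1 *: v); rewrite ?linearZ//= normrZ normfV normr_id mulVf ?normr_eq0.
Qed.

Lemma norm_le_dual_norm y v : `|y v| <= dual_norm y * `|v|.
Proof.
rewrite ler_norml le_dual_norm andbT lerNl -normrN.
by rewrite -linearN le_dual_norm.
Qed.

Lemma dual_norm_le y (M : R) : 0 <= M -> (forall v, y v <= M * `|v|) ->
  dual_norm y <= M.
Proof.
move=> M0 HM; apply: ge_sup; first by have [] := has_sup_dual_norm y.
by move=> _ [v /= v1 <-]; rewrite (le_trans (HM v))// ler_piMr.
Qed.

Lemma dual_normN y : dual_norm (- y) = dual_norm y.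
Proof.
apply/eqP; rewrite eq_le; apply/andP; split;
  apply: dual_norm_le (dual_norm_ge0 _) _ => v.
  by rewrite opp_lfunE -linearN -(normrN v) le_dual_norm.
by rewrite -[y v]opprK -opp_lfunE -linearN -(normrN v) le_dual_norm.
Qed.

Lemma dual_normD y z : dual_norm (y + z) <= dual_norm y + dual_norm z.
Proof.
apply: dual_norm_le => [|v]; first by rewrite addr_ge0 ?dual_norm_ge0.
by rewrite add_lfunE mulrDl lerD ?le_dual_norm.
Qed.

Lemma dual_norm_dist y z : `|dual_norm y - dual_norm z| <= dual_norm (y - z).
Proof.
have := dual_normD (y - z) z; have := dual_normD (z - y) y.
by rewrite !subrK -(dual_normN (z - y)) opprB ler_norml; lra.
Qed.

(** Parametrizes the dual by row vectors, whose topology and rational boxes serve for continuity and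
    measurability. *)
Definition form_of_row r : V' :=
  \sum_i r 0 i *: linfun (coord e i : V -> R^o).

Lemma form_of_rowE r v : form_of_row r v = \sum_i r 0 i * coord e i v.
Proof.
rewrite sum_lfunE; apply: eq_bigr => i _.
by rewrite scale_lfunE lfunE.
Qed.

Lemma form_of_row_vbasis y : form_of_row (\row_i y e`_i) = y.
Proof.
apply/lfunP => v; rewrite form_of_rowE [in RHS](sum_coord_vbasis v) linear_sum.
by apply: eq_bigr => i _; rewrite mxE linearZ/= mulrC.
Qed.

(** Lipschitz dependence of a form on its row, used to transfer continuity in the dual norm to
    rows. *)
Lemma dual_norm_form_of_row : exists2 C : R, 0 < C &
  forall r s, dual_norm (form_of_row r - form_of_row s) <= C * `|r - s|.
Proof.
have [C C0 HC] := coord_bound.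
(* The added [1] keeps the constant positive in dimension zero. *)
exists (n%:R * C + 1); first by rewrite ltr_wpDl ?mulr_ge0 ?(ltW C0).
move=> r s; apply: dual_norm_le => [|v].
  by rewrite mulr_ge0// addr_ge0// mulr_ge0// ltW.
rewrite add_lfunE opp_lfunE !form_of_rowE -sumrB.
apply: (@le_trans _ _ (\sum_(i < n) `|r - s| * (C * `|v|))).
  apply: ler_sum => i _; rewrite -mulrBl; apply: (le_trans (ler_norm _)).
  rewrite normrM ler_pM// [leRHS]/Num.norm/= mx_normrE.
  by apply/bigmax_geP; right => /=; exists (0, i) => //=; rewrite !mxE.
rewrite sumr_const card_ord -mulr_natl.
have : 0 <= `|r - s| * `|v| by rewrite mulr_ge0.
set a := `|r - s|; set b := `|v|; set m : R := n%:R => ab.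
by move: ab; rewrite -subr_ge0 => ab; rewrite -subr_ge0 (_ : _ - _ = a * b - 0)//; ring.
Qed.

End finite_dimensional.

(** An open set of rows is the union of the countably many boxes with rational centre and radius
    [1/(k+1)] that it contains, and a box pulls back to a finite intersection of coordinate
    conditions. *)
Lemma measurable_preimage_open_row {R : realType} d (T : measurableType d) n
    (r : T -> 'rV[R]_n) (O : set 'rV[R]_n) :
  (forall i, measurable_fun setT (fun w => r w 0 i)) ->
  open O -> measurable (r @^-1` O).
Proof.
move=> mr oO.
pose box (c : 'rV[rat]_n * nat) : set 'rV[R]_n :=
  [set s | forall i, `|s 0 i - ratr (c.1 0 i)| < c.2.+1%:R^-1].
pose I := [set c | box c `<=` O].
have -> : r @^-1` O = \bigcup_(c in I) (r @^-1` (box c)).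
  apply/seteqP; split => [w /= Ow|w [c Ic /= bw]]; last exact: Ic.
  have /nbhs_ballP[eps /= eps0 sub] : nbhs (r w) O by exact: open_nbhs_nbhs.
  (* A box of radius below [eps / 2] whose centre is that close to [r w] lies in the [eps]-ball
     around [r w]. *)
  have [k Hk] : exists k, k.+1%:R^-1 < eps / 2.
    have e20 : 0 < eps / 2 by rewrite divr_gt0.
    by have [k _ /(_ k (leqnn k))] := near_infty_natSinv_lt (PosNum e20); exists k.
  have Hq i : {q : rat | `|r w 0 i - ratr q| < k.+1%:R^-1}.
    apply: cid; have [|q] := @rat_in_itvoo R (r w 0 i - k.+1%:R^-1) (r w 0 i + k.+1%:R^-1).
      by rewrite ltrBlDr -addrA ltrDl addr_gt0.
    by rewrite in_itv/= => qP; exists q; rewrite distrC ltr_distl.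
  pose q := \row_i sval (Hq i).
  exists (q, k) => [s /= sP|i /=]; last by rewrite mxE; exact: (svalP (Hq i)).
  apply: sub; rewrite -ball_normE/=.
  rewrite [ltLHS]/Num.norm/= mx_normrE; apply/bigmax_ltP; split => // -[i0 i] _ /=.
  rewrite !mxE ord1 -(subrK (ratr (q 0 i)) (r w 0 i)) -addrA.
  rewrite (le_lt_trans (ler_normD _ _))// (splitr eps) ltrD//.
    by rewrite mxE (lt_trans (svalP (Hq i)))//.
  by rewrite distrC (lt_trans (sP i)).
have mbox c : measurable (r @^-1` (box c)).
  rewrite (_ : r @^-1` _ = \bigcap_(i in [set: 'I_n])
     ((fun w => r w 0 i) @^-1` (ball (ratr (c.1 0 i) : R) c.2.+1%:R^-1))).
    apply: fin_bigcap_measurable => // i _.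
    rewrite -[X in measurable X]setTI; apply: mr => //.
    exact: measurable_ball.
  apply/seteqP; split => w /= H i; last by rewrite distrC; exact: (H i).
  by move=> _; rewrite -ball_normE/= distrC; exact: H.
rewrite bigcup_mkcond; apply: countable_bigcupT_measurable => [|c].
  exact: countableP.
by case: ifPn.
Qed.

(** * Measurability through coordinates *)

Section measurability.
Context {R : realType} {V : normedVectType R}.
Context d {T : measurableType d}.
Local Notation V' := 'Hom(V, R^o).
Local Notation e := (vbasis {:V}).

Lemma measurable_real_opens (g : T -> R) :
  (forall O : set R, open O -> measurable (g @^-1` O)) -> measurable_fun setT g.
Proof.
move=> H; apply: (measurability _ (RGenOpens.measurableE R)).
move=> _ [_ [a [b ->] <-]]; rewrite setTI; apply: H; exact: interval_open.
Qed.

Lemma measurable_borel_opens (x : T -> V) :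
  (forall O : set V, open O -> measurable (x @^-1` O)) ->
  measurable_fun setT (x : T -> borel_type V).
Proof.
move=> H; apply: (@measurability _ _ T (borel_type V) setT x (@open V)) => //.
by move=> _ [W oW <-]; rewrite setTI; exact: H.
Qed.

Lemma measurable_borel_preimage (x : T -> V) (O : set V) :
  measurable_fun setT (x : T -> borel_type V) -> open O -> measurable (x @^-1` O).
Proof.
move=> mx oO; rewrite -[X in measurable X]setTI; apply: (mx measurableT O).
exact: sub_sigma_algebra.
Qed.

Lemma measurable_borel_coord (x : T -> V) :
  (forall i, measurable_fun setT (fun w => coord e i (x w))) ->
  measurable_fun setT (x : T -> borel_type V).
Proof.
move=> mx; apply: measurable_borel_opens => O oO.
pose r w : 'rV[R]_(\dim {:V}) := \row_i coord e i (x w).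
rewrite (_ : x @^-1` O = r @^-1` (vec_of_row @^-1` O)); last first.
  by apply/seteqP; split => w /=; rewrite vec_of_row_coord.
apply: measurable_preimage_open_row => [i|].
  by under eq_fun do rewrite mxE; exact: mx.
by apply: open_comp => // s _; exact: vec_of_row_continuous.
Qed.

(** A relatively open subset of [D] is the trace of an open [W]; as [x] stays in [D], its preimage
    under [x] is that of [W]. *)
Lemma measurable_continuous_within (D : set V) (g : V -> R) (x : T -> V) :
  {within D, continuous g} -> (forall w, D (x w)) ->
  measurable_fun setT (x : T -> borel_type V) ->
  measurable_fun setT (g \o x).
Proof.
move=> /continuousP cg Dx mx; apply: measurable_real_opens => O /cg.
move=> /open_subspaceP[W oW WD].
rewrite (_ : _ @^-1` O = x @^-1` W); first exact: measurable_borel_preimage.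
apply/seteqP; split => w /= H.
  by have : (W `&` D) (x w) by [rewrite WD]; move=> [].
by have : (g @^-1` O `&` D) (x w) by [rewrite -WD]; move=> [].
Qed.

Lemma measurable_coord (x : T -> V) i :
  measurable_fun setT (x : T -> borel_type V) ->
  measurable_fun setT (fun w => coord e i (x w)).
Proof.
move=> mx; apply: (@measurable_continuous_within setT (coord e i)) => //.
by apply: continuous_subspaceT => v; exact: coord_vbasis_continuous.
Qed.

(* The topology of ['Hom(V, R^o)] is carried by its coordinates. *)
Lemma measurable_form_preimage (Z : topologicalType) (F : V' -> Z) (Y : T -> V')
    (O : set Z) :
  continuous (F \o form_of_row) ->
  (forall v, measurable_fun setT (fun w => Y w v : R)) ->
  open O -> measurable ((F \o Y) @^-1` O).
Proof.
move=> cF mY oO.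
pose r w : 'rV[R]_(\dim {:V}) := \row_i Y w e`_i.
rewrite (_ : _ @^-1` O = r @^-1` ((F \o form_of_row) @^-1` O)); last first.
  by apply/seteqP; split => w /=; rewrite form_of_row_vbasis.
apply: measurable_preimage_open_row => [i|].
  by under eq_fun do rewrite mxE; exact: mY.
by apply: open_comp => // s _; exact: cF.
Qed.

Lemma dual_norm_continuous : continuous (@dual_norm R V \o form_of_row).
Proof.
have [C C0 HC] := @dual_norm_form_of_row R V.
move=> r; apply/(@cvgrPdist_lt _ R^o _ _ (nbhs_filter r)) => eps eps0.
near=> s.
apply: (le_lt_trans (dual_norm_dist _ _)); apply: (le_lt_trans (HC _ _)).
rewrite -ltr_pdivlMl//; near: s.
by apply: cvgr_dist_lt; rewrite ?mulr_gt0 ?invr_gt0.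
Unshelve. all: end_near. Qed.

Lemma measurable_dual_norm (Y : T -> V') :
  (forall v, measurable_fun setT (fun w => Y w v : R)) ->
  measurable_fun setT (fun w => dual_norm (Y w)).
Proof.
move=> mY; apply: measurable_real_opens => O oO.
exact: (@measurable_form_preimage R (@dual_norm R V) Y O dual_norm_continuous).
Qed.

Lemma measurable_form_apply (Y : T -> V') (x : T -> V) :
  (forall v, measurable_fun setT (fun w => Y w v : R)) ->
  measurable_fun setT (x : T -> borel_type V) ->
  measurable_fun setT (fun w => Y w (x w) : R).
Proof.
move=> mY mx.
rewrite (_ : (fun _ => _) =
    (fun w => \sum_i coord e i (x w) * (Y w e`_i : R))); last first.
  apply/funext => w; rewrite [in LHS](sum_coord_vbasis (x w)) linear_sum.
  by apply: eq_bigr => i _; rewrite linearZ.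
apply: measurable_sum => i; apply: measurable_funM; first exact: measurable_coord.
exact: mY.
Qed.

End measurability.

(** * Independence of the current seed from the past *)

Section independence.
Local Open Scope ereal_scope.
Context {R : realType} {dO} {Omega : measurableType dO} {P : probability Omega R}.
Context {dS} {S : measurableType dS} {mu : probability S R}.

Section freezing.
Context {dE} {E : measurableType dE}.
Variables (Z : {RV P >-> E}) (W : {RV P >-> S}).
Hypothesis indep : forall A B, measurable A -> measurable B ->
  P (Z @^-1` A `&` W @^-1` B) = P (Z @^-1` A) * mu B.

Let mZW : measurable_fun setT (fun w => (Z w, W w)).
Proof. by apply/measurable_fun_pairP; split; exact: measurable_funPT. Qed.

Let ZW : {RV P >-> (E * S)%type} :=
  HB.pack (fun w => (Z w, W w)) (isMeasurableFun.Build _ _ _ _ _ mZW).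

(** Independence makes the joint law agree with the product on rectangles, which determines it. *)
Let joint_product A : measurable A ->
  (distribution P Z \x mu) A = distribution P ZW A.
Proof.
apply: product_measure_unique => B C mB mC.
by rewrite /distribution /pushforward -indep.
Qed.

Lemma ge0_integral_freeze_le (g : E * S -> \bar R) (c : \bar R) :
  measurable_fun setT g -> (forall z, 0 <= g z) ->
  (forall z, \int[mu]_s g (z, s) <= c) ->
  \int[P]_w g (Z w, W w) <= c.
Proof.
move=> mg g0 gc; rewrite -(ge0_integral_distribution ZW)//.
rewrite (eq_measure_integral (distribution P Z \x mu)); last first.
  by move=> A mA _; exact/esym/joint_product.
rewrite fubini_tonelli1//; apply: (@le_trans _ _ (\int[distribution P Z]_z cst c z)).
  apply: ge0_le_integral => //.
  - by move=> z _; exact: integral_ge0.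
  - exact: measurable_fun_fubini_tonelli_F.
  - by move=> z _; exact: gc.
by rewrite integral_cst//= [distribution P Z _]probability_setT mule1.
Qed.

(** The signed version: Fubini applies once integrability is carried from [P] through the joint law
    to the product law. *)
Lemma integral_freeze_eq0 (g : E * S -> \bar R) : measurable_fun setT g ->
  P.-integrable setT (fun w => g (Z w, W w)) ->
  (forall z, \int[mu]_s g (z, s) = 0) ->
  \int[P]_w g (Z w, W w) = 0.
Proof.
move=> mg ig g0; rewrite -(integral_distribution (X := ZW))//.
rewrite (eq_measure_integral (distribution P Z \x mu)); last first.
  by move=> A mA _; exact/esym/joint_product.
have jg : (distribution P ZW).-integrable setT g by exact: integrable_pushforward.
have pg : (distribution P Z \x mu).-integrable setT g.
  apply/integrableP; split => //; move/integrableP : jg => [_].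
  rewrite (eq_measure_integral (distribution P Z \x mu))// => A mA _.
  by exact/esym/joint_product.
rewrite -integral12_prod_meas1//=.
by rewrite (eq_integral (cst 0)) ?integral0// => z _; exact: g0.
Qed.

End freezing.

Section past.
Variable omega : nat -> {RV P >-> S}.
Implicit Types (t : nat) (A : nat -> set S).

(** [index_iota 1 t] stops at [t - 1]: only seeds strictly before [t] are constrained. *)
Definition seed_cylinder t A : set Omega :=
  \bigcap_(s in [set` index_iota 1 t]) omega s @^-1` A s.

Definition seed_cylinders t : set (set Omega) :=
  [set B | exists2 A, (forall s, measurable (A s)) & B = seed_cylinder t A].

(* The sigma-algebra generated by [omega 1, ..., omega t.-1]. *)
Definition past t := g_sigma_algebraType (seed_cylinders t).

Lemma seed_cylinders_measurable t : seed_cylinders t `<=` measurable.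
Proof.
move=> _ [A mA ->]; apply: fin_bigcap_measurable => [|s _]; first exact: finite_seq.
exact: measurable_funPTI.
Qed.

Lemma seed_cylindersI t : setI_closed (seed_cylinders t).
Proof.
move=> _ _ [A mA ->] [B mB ->]; exists (fun s => A s `&` B s).
  by move=> s; exact: measurableI.
rewrite /seed_cylinder -bigcapI.
by apply: eq_bigcapr => s _; rewrite preimage_setI.
Qed.

Lemma past_id_measurable t : measurable_fun setT (id : Omega -> past t).
Proof.
apply: (@measurability _ _ Omega (past t) setT id (seed_cylinders t)) => //.
by move=> _ [W GW <-]; rewrite setTI; exact: (@seed_cylinders_measurable t W).
Qed.

Lemma pastS_id_measurable t : measurable_fun setT (id : past t.+1 -> past t).
Proof.
apply: (@measurability _ _ (past t.+1) (past t) setT id (seed_cylinders t)) => //.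
move=> _ [_ [A mA ->] <-]; rewrite setTI; apply: sub_sigma_algebra.
(* The same cylinder seen one time later: index [t] is left unconstrained. *)
exists (fun s => if (s < t)%N then A s else setT).
  by move=> s; case: ifP.
rewrite /seed_cylinder preimage_id; apply/seteqP; split => w H s /=.
  rewrite mem_index_iota => /andP[s0 st]; case: ifPn => // st'; apply: H => /=.
  by rewrite mem_index_iota s0.
rewrite mem_index_iota => /andP[s0 st].
by have := H s; rewrite /= mem_index_iota s0 ltnW// st; apply.
Qed.

Lemma seed_past_measurable t : (0 < t)%N ->
  measurable_fun setT (omega t : past t.+1 -> S).
Proof.
move=> t0 _ B mB; rewrite setTI; apply: sub_sigma_algebra.
(* A cylinder with a condition at [t] alone, which is in the index range of [past t.+1]. *)
exists (fun s => if s == t then B else setT).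
  by move=> s; case: ifP.
apply/seteqP; split => [w Bw s /= _|w H]; first by case: ifPn => // /eqP ->.
by have := H t; rewrite /= mem_index_iota t0 ltnSn eqxx; apply.
Qed.

Hypothesis iid : iid_seeds mu omega.

Lemma seed_cylinder_indep t A B : (0 < t)%N -> (forall s, measurable (A s)) ->
  measurable B ->
  P (seed_cylinder t A `&` omega t @^-1` B) = P (seed_cylinder t A) * mu B.
Proof.
move=> t0 mA mB; have [law indep] := iid.
(* Putting [B] at index [t] makes the left side one finite intersection over distinct indices, to
   which independence applies as a whole. *)
pose A' s := if s == t then B else A s.
have tI : t \notin index_iota 1 t by rewrite mem_index_iota ltnn andbF.
have A'E : {in index_iota 1 t, A' =1 A}.
  by move=> s; rewrite /A'; case: eqP => // ->; rewrite (negbTE tI).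
have -> : seed_cylinder t A `&` omega t @^-1` B =
    \bigcap_(s in [set` t :: index_iota 1 t]) omega s @^-1` A' s.
  rewrite (_ : [set` _] = t |` [set` index_iota 1 t]); last first.
    apply/seteqP; split => s /=; rewrite inE => /predU1P.
      by move=> [->|sI]; [left|right].
    by [].
  rewrite bigcap_setU1 setIC /A' eqxx; congr (_ `&` _).
  by apply: eq_bigcapr => s sI; rewrite -/(A' s) A'E.
rewrite indep.
- rewrite big_cons /A' eqxx law// muleC; congr (_ * _).
  rewrite /seed_cylinder indep ?iota_uniq//; last first.
    by move=> s; rewrite mem_index_iota => /andP[].
  by apply: eq_big_seq => s sI; rewrite -/(A' s) A'E.
- by rewrite cons_uniq tI iota_uniq.
- by move=> s; rewrite inE mem_index_iota => /orP[/eqP->|/andP[]].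
- by move=> s; rewrite /A'; case: ifP.
Qed.

(** Both sides are finite measures in [A]: [P] restricted to the event of the seed, and [P] scaled
    by [mu B]. They agree on the cylinders, a family closed under intersection that generates
    [past t]. *)
Lemma past_indep t (A : set (past t)) B : (0 < t)%N -> measurable A ->
  measurable B -> P (A `&` omega t @^-1` B) = P A * mu B.
Proof.
move=> t0 mA mB.
have mW : measurable (omega t @^-1` B) by exact: measurable_funPTI.
have muB : mu B \is a fin_num by exact: fin_num_measure.
have muB0 : (0 <= fine (mu B))%R by rewrite fine_ge0.
have scaleE C : mscale (NngNum muB0) P C = P C * mu B.
  by rewrite /mscale/= fineK// muleC.
rewrite -scaleE; apply: (g_sigma_algebra_measure_unique (seed_cylinders t)
  (@seed_cylinders_measurable t) (fun=> setT) _ _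
  (mrestr P mW) (mscale (NngNum muB0) P) (@seed_cylindersI t)) => //.
- move=> _; exists (fun=> setT) => //.
  by apply/seteqP; split.
- by rewrite bigcup_const.
- move=> _ [A' mA' ->].
  by rewrite [LHS]seed_cylinder_indep// -scaleE.
- move=> _; apply: (@le_lt_trans _ _ 1); last exact: ltry.
  by apply: probability_le1; exact: measurableI.
Qed.

End past.

End independence.

(** * Mirror map and dual averaging *)

Lemma le_diameter {R : realType} {V : normedVectType R} (X : set V) u v :
  compact X -> X u -> X v -> `|u - v| <= diameter X.
Proof.
move=> /compact_bounded[M [Mreal HM]] Xu Xv; apply: ub_le_sup; last by exists v, u.
exists (M + 1 + (M + 1)) => _ [a [b [Xa Xb ->]]].
by rewrite (le_trans (ler_normB _ _))// lerD// HM// ltrDl.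
Qed.

(** * Convex functions finite on the feasible set *)

Section convex_on_compact.
Context {R : realType} {V : normedVectType R}.
Local Notation V' := 'Hom(V, R^o).
Implicit Types (X : set V) (f : V -> \bar R) (x : V) (y : V').

Lemma fine_continuous_within X f : (forall z, X z -> f z \is a fin_num) ->
  {within X, continuous f} -> {within X, continuous (fine \o f)}.
Proof.
move=> ffin /subspace_continuousP cf; apply/subspace_continuousP => x Xx.
by apply: fine_cvg; rewrite fineK ?ffin//; exact: cf.
Qed.

Lemma subdiff_le X f x y x' : (forall z, X z -> f z \is a fin_num) ->
  X x -> X x' -> subdiff f x y -> fine (f x) + y (x' - x) <= fine (f x').
Proof.
move=> ffin Xx Xx' /(_ x').
by rewrite -{1}(fineK (ffin _ Xx)) -{1}(fineK (ffin _ Xx')) -EFinD lee_fin.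
Qed.

Lemma convex_ext_fine X f x x' (t : R) : (forall z, X z -> f z \is a fin_num) ->
  convex_ext f -> X x -> X x' -> 0 < t < 1 ->
  (f (t *: x + (1 - t) *: x')%R <= (t * fine (f x) + (1 - t) * fine (f x'))%:E)%E.
Proof.
move=> ffin [_ cf] Xx Xx' t01; apply: (le_trans (cf _ _ _ t01)).
by rewrite [in leRHS]EFinD !EFinM !fineK ?ffin.
Qed.

End convex_on_compact.

(** Replaces the passage to the limit [s -> 0] in difference quotients. *)
Lemma le0_of_le_small {R : realType} (a b : R) :
  (forall s, 0 < s < 1 -> a <= s * b) -> a <= 0.
Proof.
move=> H; rewrite leNgt; apply/negP => a0.
have b0 : 0 < b.
  have : 0 < (1 / 2 : R) < 1 by lra.
  by move=> /H; lra.
(* At [s = a / (2 (a + b))] the product [s b] is below [a / 2], against the hypothesis. *)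
have c0 : 0 < a / (2 * (a + b)) < 1.
  rewrite divr_gt0 ?mulr_gt0 ?addr_gt0//= ltr_pdivrMr ?mulr_gt0 ?addr_gt0//; lra.
have := H _ c0; rewrite mulrAC ler_pdivlMr ?mulr_gt0 ?addr_gt0//.
nra.
Qed.

(** * Subgradients of the regularizer *)

Section mirror_descent.
Context {R : realType} {V : normedVectType R}.
Local Notation V' := 'Hom(V, R^o).
Local Notation e := (vbasis {:V}).
Variables (X : set V) (h : V -> \bar R) (gradh : V -> V') (K : R).
Hypotheses (X0 : X !=set0) (cX : compact X) (ch : convex_ext h).
Hypotheses (domh : [set z | (h z < +oo)%E] = X) (conth : {within X, continuous h}).
Hypotheses (selh : continuous_selection h gradh).
Hypotheses (K0 : 0 < K) (sc : strongly_convex h gradh K X).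
Implicit Types (u v x : V) (y : V').
Local Notation hr := (fine \o h).
Local Notation Q := (mirror_map X h).

Lemma dom_ltoo v : (h v < +oo)%E -> X v.
Proof. by rewrite -domh. Qed.

Lemma dom_fin_num v : X v -> h v \is a fin_num.
Proof. by rewrite -domh /= fin_numE => hv; rewrite (proj1 ch) lt_eqF. Qed.

Lemma subdiff_dom x y : subdiff h x y -> X x.
Proof.
move=> sxy; apply: dom_ltoo; have [v Xv] := X0; have := sxy v.
rewrite -(fineK (dom_fin_num _ Xv)); case: (h x) => [r _| |//]; first exact: ltry.
by rewrite addye.
Qed.

(** Off [X] the value of [h] is [+oo], so the inequality can be tested on [X]; finiteness of [h]
    somewhere forces the base point into [X]. *)
Lemma subdiffP x y :
  subdiff h x y <-> X x /\ forall v, X v -> hr x + y (v - x) <= hr v.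
Proof.
split => [sxy|[Xx H] v].
  have Xx := subdiff_dom _ _ sxy; split => // v Xv.
  by apply: (@subdiff_le _ _ X) => //; exact: dom_fin_num.
have [Xv|nXv] := pselect (X v).
  rewrite -(fineK (dom_fin_num _ Xx)) -(fineK (dom_fin_num _ Xv)) -EFinD lee_fin.
  exact: H.
suff -> : h v = +oo%E by rewrite leey.
by apply/eqP; apply: contra_notT nXv; rewrite -ltey => /dom_ltoo.
Qed.

Lemma dom_convex x x' (t : R) : X x -> X x' -> 0 < t < 1 ->
  X (t *: x + (1 - t) *: x').
Proof.
move=> Xx Xx' t01; apply: dom_ltoo.
exact: le_lt_trans (convex_ext_fine _ _ _ _ _ dom_fin_num ch Xx Xx' t01) (ltry _).
Qed.

Lemma hr_convex x x' (t : R) : X x -> X x' -> 0 < t < 1 ->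
  hr (t *: x + (1 - t) *: x') <= t * hr x + (1 - t) * hr x'.
Proof.
move=> Xx Xx' t01; rewrite -lee_fin fineK ?dom_fin_num//; last exact: dom_convex.
exact: (convex_ext_fine _ _ _ _ _ dom_fin_num ch Xx Xx' t01).
Qed.

Lemma hr_continuous : {within X, continuous hr}.
Proof. exact: fine_continuous_within dom_fin_num conth. Qed.

(** Both extrema are attained at points where [h] is finite, so [fine] loses nothing in
    [range_width]. *)
Lemma range_width_le u v : X u -> X v -> hr u - hr v <= range_width X h.
Proof.
move=> Xu Xv.
have [a aX Ha] := compact_EVT_max X0 cX hr_continuous.
have [b bX Hb] := compact_EVT_min X0 cX hr_continuous.
have Xa := set_mem aX; have Xb := set_mem bX.
have -> : range_width X h = hr a - hr b.
  rewrite /range_width.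
  have -> : ereal_sup (h @` X) = h a.
    apply/eqP; rewrite eq_le; apply/andP; split; last first.
      by apply: ereal_sup_ubound; exists a.
    apply: ge_ereal_sup => _ [w Xw <-].
    rewrite -(fineK (dom_fin_num _ Xa)) -(fineK (dom_fin_num _ Xw)) lee_fin.
    exact/Ha/mem_set.
  have -> : ereal_inf (h @` X) = h b.
    apply/eqP; rewrite eq_le; apply/andP; split.
      by apply: ereal_inf_lbound; exists b.
    apply: le_ereal_inf_tmp => _ [w Xw <-].
    rewrite -(fineK (dom_fin_num _ Xb)) -(fineK (dom_fin_num _ Xw)) lee_fin.
    exact/Hb/mem_set.
  by rewrite fineB ?dom_fin_num.
by rewrite lerB ?Ha ?Hb// mem_set.
Qed.

(* A minimizer of [h + c |. - z|^2] for the Euclidean norm of the coordinates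
   carries an explicit subgradient of [h], and approaches [z] as [c] grows. *)
Lemma dom_subdiff_dense z (eps : R) : X z -> 0 < eps ->
  exists2 u, dom_subdiff h u & `|u - z| < eps.
Proof.
move=> Xz eps0.
pose B u v : R := \sum_i coord e i u * coord e i v.
have BD u v w : B u (v + w) = B u v + B u w.
  by rewrite -big_split; apply: eq_bigr => i _; rewrite linearD mulrDr.
have BZ u v a : B u (a *: v) = a * B u v.
  by rewrite mulr_sumr; apply: eq_bigr => i _; rewrite linearZ/= mulrCA.
have BC u v : B u v = B v u by apply: eq_bigr => i _; rewrite mulrC.
have Bge0 u : 0 <= B u u by apply: sumr_ge0 => i _; rewrite -expr2 sqr_ge0.
have [b bX Hb] := compact_EVT_min X0 cX hr_continuous.
pose M : R := \sum_(i < \dim {:V}) `|e`_i|.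
have M0 : 0 <= M by apply: sumr_ge0.
(* Coordinates of [u - z] bounded by [dl] give a norm of at most [dl M], which is below [eps]. *)
pose dl := eps / (M + 1).
have dl0 : 0 < dl by rewrite divr_gt0// ltr_wpDl.
(* With this weight a squared deviation [dl^2] costs [hr z - hr b + 1], more than leaving [z] can
   gain in [hr]. *)
pose lam := (hr z - hr b + 1) / dl ^+ 2.
have hzb : hr b <= hr z by apply: Hb; rewrite mem_set.
have lam0 : 0 < lam by rewrite divr_gt0 ?exprn_gt0// ltr_wpDl ?subr_ge0.
have [u uX Hu] : exists2 u, u \in X & forall v, v \in X ->
    hr u + lam * B (u - z) (u - z) <= hr v + lam * B (v - z) (v - z).
  apply: (@compact_EVT_min _ _ (fun v => hr v + lam * B (v - z) (v - z))) => //.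
  have cB : continuous (fun v => lam * B (v - z) (v - z)).
    have cc i : continuous (fun v => coord e i (v - z)).
      move=> v; apply: (@continuous_comp _ _ _ (fun v => v - z)).
        by apply: cvgB; [exact: cvg_id|exact: cvg_cst].
      exact: coord_vbasis_continuous.
    move=> v; apply: cvgM; first exact: cvg_cst.
    rewrite /B /continuous_at; elim: (index_enum _) => [|i s IH].
      under eq_fun do rewrite big_nil.
      by rewrite big_nil; exact: cvg_cst.
    rewrite big_cons; under eq_fun do rewrite big_cons.
    by apply: cvgD => //; apply: cvgM; exact: cc.
  move=> v; apply: (@cvgD _ R^o); first exact: hr_continuous.
  by move: v; exact: continuous_subspaceT.
have Xu := set_mem uX.
exists u.
  (* The gradient at [u] of minus the quadratic penalty, as stationarity suggests. *)
  exists (form_of_row (\row_i (- (2 * lam * coord e i (u - z))))).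
  apply/subdiffP; split => // v Xv.
  have -> : form_of_row (\row_i (- (2 * lam * coord e i (u - z)))) (v - u) =
      - (2 * lam) * B (u - z) (v - u).
    rewrite form_of_rowE mulr_sumr; apply: eq_bigr => i _.
    rewrite mxE; ring.
  rewrite -subr_le0.
  (* Compare [u] with [u + s (v - u)]: convexity of [hr] and expansion of the square leave [s] times
     the claim up to a term of order [s^2]. *)
  apply: (@le0_of_le_small _ _ (lam * B (v - u) (v - u))) => s s01.
  have /andP[s0 s1] := s01.
  have Xw := @dom_convex _ _ s Xv Xu s01.
  have := Hu _ (mem_set Xw); have := @hr_convex _ _ s Xv Xu s01.
  have -> : s *: v + (1 - s) *: u - z = (u - z) + s *: (v - u).
    by rewrite scalerBl scale1r scalerBr addrCA [RHS]addrAC.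
  move: (u - z) (v - u) => q w.
  rewrite BD BZ ![B (_ + _) _]BC !BD !BZ [B w q]BC => H1 H2.
  rewrite -(ler_pM2l s0); nra.
rewrite (sum_coord_vbasis (u - z)).
apply: (le_lt_trans (ler_norm_sum _ _ _)).
have cle i : `|coord e i (u - z)| <= dl.
  rewrite -(@ler_pXn2r _ 2) ?nnegrE ?(ltW dl0)// real_normK ?num_real//.
  have H1 : coord e i (u - z) ^+ 2 <= B (u - z) (u - z).
    rewrite /B (bigD1 i)//= -expr2 lerDl; apply: sumr_ge0 => j _.
    by rewrite -expr2 sqr_ge0.
  have H2 := Hu _ (mem_set Xz).
  have H3 : hr b <= hr u by apply: Hb.
  have B0 : B (z - z) (z - z) = 0.
    by rewrite subrr; apply: big1 => j _; rewrite linear0 mul0r.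
  move: H2; rewrite B0 mulr0 addr0 => H2; apply: (le_trans H1).
  rewrite -(ler_pM2l lam0) {2}/lam divfK ?expf_neq0 ?gt_eqF//.
  lra.
apply: (@le_lt_trans _ _ (\sum_(i < \dim {:V}) dl * `|e`_i|)).
  by apply: ler_sum => i _; rewrite normrZ ler_wpM2r.
rewrite -mulr_sumr -/M /dl mulrAC ltr_pdivrMr ?ltr_wpDl//.
by rewrite ltr_pM2l// ltrDl.
Qed.

Lemma subdiff_monotone x x' y y' : subdiff h x y -> subdiff h x' y' ->
  0 <= (y' - y) (x' - x).
Proof.
move=> /subdiffP[Xx H] /subdiffP[Xx' H'].
have := H _ Xx'; have := H' _ Xx.
rewrite add_lfunE opp_lfunE -(opprB x' x) linearN => /=; lra.
Qed.

(* Compare [y] with [gradh u] by monotonicity, for [u] in the domain close to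
   [x + t (p - x)], and let [t] tend to [0]. *)
Lemma subdiff_le_selection x y p : subdiff h x y -> X p ->
  y (p - x) <= gradh x (p - x).
Proof.
move=> sxy Xp; have Xx := subdiff_dom _ _ sxy.
have Dx : dom_subdiff h x by exists y.
rewrite -subr_le0 leNgt; apply/negP => c0.
set w := p - x in c0 *; set c := y w - gradh x w in c0.
(* Tolerance making the variation of [gradh] contribute at most [c / 4] along [w]. *)
pose eta := c / (4 * (`|w| + 1)).
have w1 : 0 < `|w| + 1 by rewrite ltr_wpDl.
have eta0 : 0 < eta by rewrite divr_gt0// mulr_gt0.
have /cvgrPdist_lt/(_ _ eta0) := selh.2 x Dx.
rewrite near_withinE => /nbhs_ballP[r /= r0 Hr].
(* [N] bounds the dual norm of [gradh u - y] for [u] close to [x], and [dl] is set so that using [u]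
   in place of [x + t w] costs at most [t c / 4]. *)
pose N := dual_norm (gradh x - y) + eta.
have N0 : 0 < N by rewrite ltr_wpDl// dual_norm_ge0.
pose dl := c / (4 * N).
have dl0 : 0 < dl by rewrite divr_gt0// mulr_gt0.
have S0 : 0 < `|w| + dl + r by rewrite addr_gt0// ltr_wpDl.
(* Small enough for every [u] within [t dl] of [x + t w] to lie within [r] of [x]. *)
pose t := r / (2 * (`|w| + dl + r)).
have t0 : 0 < t by rewrite divr_gt0// mulr_gt0.
have t1 : t < 1.
  rewrite ltr_pdivrMr ?mulr_gt0// mul1r.
  by have := normr_ge0 w; lra.
have tr : t * (`|w| + dl) < r.
  rewrite /t mulrAC ltr_pdivrMr ?mulr_gt0// ltr_pM2l//.
  by have := normr_ge0 w; lra.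
have Xz : X (x + t *: w).
  have -> : x + t *: w = t *: p + (1 - t) *: x.
    by rewrite scalerBl scale1r scalerBr [RHS]addrCA.
  by apply: dom_convex => //; rewrite t0.
have [u Du Hu] := @dom_subdiff_dense _ (t * dl) Xz (mulr_gt0 t0 dl0).
have ux : `|u - x| < r.
  rewrite (_ : u - x = (u - (x + t *: w)) + t *: w); last first.
    by rewrite opprD addrA subrK.
  apply: (le_lt_trans (ler_normD _ _)); rewrite normrZ (gtr0_norm t0).
  by apply: (lt_trans _ tr); rewrite mulrDr addrC ltrD2l.
have gu : dual_norm (gradh u - gradh x) < eta.
  have := Hr u; rewrite -ball_normE/= distrC => /(_ ux Du).
  by rewrite sub0r normrN ger0_norm// dual_norm_ge0.
have := subdiff_monotone _ _ _ _ sxy (selh.1 u Du).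
have -> : u - x = t *: w + (u - (x + t *: w)) by rewrite [RHS]addrC opprD addrA subrK.
rewrite linearD linearZ/=.
set q := u - _ in Hu *.
have H1 : (gradh u - y) q <= N * (t * dl).
  apply: (le_trans (le_dual_norm _ _)).
  apply: ler_pM => //; [exact: dual_norm_ge0| |exact: ltW].
  have -> : gradh u - y = (gradh x - y) + (gradh u - gradh x).
    by rewrite [RHS]addrC addrA subrK.
  by apply: (le_trans (dual_normD _ _)); rewrite lerD2l ltW.
have H2 : (gradh u - y) w <= - c + eta * `|w|.
  have -> : gradh u - y = (gradh x - y) + (gradh u - gradh x).
    by rewrite [RHS]addrC addrA subrK.
  rewrite add_lfunE lerD//; first by rewrite add_lfunE opp_lfunE opprB.
  apply: (le_trans (le_dual_norm _ _)); rewrite ler_wpM2r//; exact: ltW.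
have H3 : eta * `|w| <= c / 4.
  rewrite /eta mulrAC ler_pdivrMr ?mulr_gt0//; have := normr_ge0 w; nra.
have H4 : N * (t * dl) = t * (c / 4) by rewrite /dl; field; rewrite gt_eqF.
rewrite [_ *: _]/(_ * _) => H5.
(* Monotonicity gives this sign, yet the bracket equals [- c / 2]. *)
have : 0 <= t * (- c + c / 4 + c / 4).
  apply: (le_trans H5); rewrite H4 in H1.
  by rewrite [leRHS]mulrDr lerD// ler_wpM2l ?(ltW t0)// (le_trans H2)// lerD2l.
rewrite pmulr_rge0//; lra.
Qed.

(** Strong convexity is assumed along the selection; it extends to every subgradient because the
    selection is the largest one in feasible directions. *)
Lemma subdiff_strong x y p : subdiff h x y -> X p ->
  hr x + y (p - x) + K / 2 * `|p - x| ^+ 2 <= hr p.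
Proof.
move=> sxy Xp; have Xx := subdiff_dom _ _ sxy.
have Dx : dom_subdiff h x by exists y.
have := sc _ _ Dx Xp.
rewrite -{1}(fineK (dom_fin_num _ Xx)) -(fineK (dom_fin_num _ Xp)) -!EFinD lee_fin.
apply: le_trans; rewrite lerD2r lerD2l; exact: subdiff_le_selection.
Qed.

(** * The mirror map *)

Lemma mirror_mapP y : X (Q y) /\ forall v, X v -> y v - hr v <= y (Q y) - hr (Q y).
Proof.
pose A := [set x | X x /\
  forall x', X x' -> ((y x')%:E - h x' <= (y x)%:E - h x)%E].
(* [get] returns a default unless the set is inhabited; a maximizer exists by compactness. *)
suff exA : exists u, A u.
  have [XQ HQ] : A (Q y) := getPex exA.
  split => // v Xv; have := HQ v Xv.
  by rewrite -(fineK (dom_fin_num _ Xv)) -(fineK (dom_fin_num _ XQ)) -!EFinB lee_fin.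
have [u uX Hu] : exists2 u, u \in X &
    forall v, v \in X -> (y v : R) - hr v <= y u - hr u.
  apply: (@compact_EVT_max _ _ (fun v => (y v : R) - hr v)) => //.
  move=> v; apply: (@cvgB _ R^o); last exact: hr_continuous.
  by move: v; apply: continuous_subspaceT; exact: form_continuous.
exists u; split; first exact: set_mem.
move=> v Xv; have Xu := set_mem uX.
rewrite -(fineK (dom_fin_num _ Xv)) -(fineK (dom_fin_num _ Xu)) -!EFinB lee_fin.
exact/Hu/mem_set.
Qed.

Lemma mirror_map_in y : X (Q y).
Proof. by have [] := mirror_mapP y. Qed.

Lemma mirror_subdiff y : subdiff h (Q y) y.
Proof.
have [XQ HQ] := mirror_mapP y; apply/subdiffP; split => // v Xv.
by have := HQ v Xv; rewrite linearB/=; lra.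
Qed.

(** Add the strong convexity inequalities at the two points, with subgradients [y] and [y'], and
    divide by the distance. *)
Lemma mirror_lipschitz y y' : K * `|Q y - Q y'| <= dual_norm (y - y').
Proof.
have H := subdiff_strong _ _ _ (mirror_subdiff y) (mirror_map_in y').
have H' := subdiff_strong _ _ _ (mirror_subdiff y') (mirror_map_in y).
have H2 := le_dual_norm (y - y') (Q y - Q y').
move: H; rewrite -(opprB (Q y) (Q y')) normrN linearN/= => H.
move: H2; rewrite add_lfunE opp_lfunE => H2.
have [->|d0] := eqVneq (`|Q y - Q y'|) 0; first by rewrite mulr0 dual_norm_ge0.
have d0' : 0 < `|Q y - Q y'| by rewrite lt_neqAle eq_sym d0 normr_ge0.
rewrite -(ler_pM2r d0').
have G (r r' a b d D : R) : r - a + K / 2 * d ^+ 2 <= r' ->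
  r' + b + K / 2 * d ^+ 2 <= r -> a - b <= D * d -> K * d * d <= D * d.
  by rewrite expr2; lra.
exact: G H H' H2.
Qed.

Lemma mirror_continuous : continuous (Q \o form_of_row).
Proof.
have [C C0 HC] := @dual_norm_form_of_row R V.
move=> r; apply/(@cvgrPdist_lt _ V _ _ (nbhs_filter r)) => eps eps0.
near=> s.
rewrite -(ltr_pM2l K0); apply: (le_lt_trans (mirror_lipschitz _ _)).
apply: (le_lt_trans (HC _ _)).
rewrite -ltr_pdivlMl//; near: s.
by apply: cvgr_dist_lt; rewrite ?mulr_gt0 ?invr_gt0// mulr_gt0.
Unshelve. all: end_near. Qed.

(** * One-step descent and pathwise regret *)

Variables (f : V -> \bar R) (gradf : V -> V') (L p : R).
Hypotheses (ffin : forall z, X z -> f z \is a fin_num).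
Hypotheses (cf : convex_ext f) (self : continuous_selection f gradf).
Hypotheses (domhf : dom_subdiff h `<=` dom_subdiff f).
Hypotheses (L0 : 0 < L) (rs : relatively_smooth f gradf h gradh L X).
Hypothesis (p12 : 1 < p <= 2).
Local Notation fr := (fine \o f).

(** The Bregman divergence taken with [gradh] is at most the one taken with [y], as [gradh x]
    dominates [y] in the direction of [q]. *)
Lemma relatively_smooth_subdiff x y q : subdiff h x y -> X q ->
  fr q <= fr x + gradf x (q - x) + L * (hr q - hr x - y (q - x)).
Proof.
move=> sxy Xq; have Xx := subdiff_dom _ _ sxy.
have Dx : dom_subdiff h x by exists y.
have := rs _ _ Dx Xq; rewrite /bregman.
rewrite -(fineK (ffin _ Xq)) -{1}(fineK (ffin _ Xx)).
rewrite -(fineK (dom_fin_num _ Xq)) -{1}(fineK (dom_fin_num _ Xx)).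
rewrite -!EFinB -EFinM -!EFinD lee_fin => /le_trans; apply.
rewrite lerD2l ler_wpM2l ?(ltW L0)// lerB//; exact: subdiff_le_selection.
Qed.

(** [V_sigma^p] without its factor [sigma^p]. *)
Definition noise_weight : R := diameter X `^ (2 - p) * (2 / K) `^ (p - 1).

(* As [Q (eta *: y)] is the maximizer, this is the scaled conjugate
   [max_x (y x - (h x - hmin) / eta)] minus [y xs]. *)
Definition potential (hmin : R) (xs : V) (eta : R) (y : V') : R :=
  y (Q (eta *: y)) - (hr (Q (eta *: y)) - hmin) / eta - y xs.

Lemma potential_descent (hmin : R) (xs : V) (eta eta' : R) (y u : V') :
  let x := Q (eta *: y) in
  let y' := y - (gradf x + u) in
  (forall v, X v -> hmin <= hr v) -> X xs ->
  0 < eta' <= eta -> L <= (p * eta)^-1 ->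
  fr (Q (eta' *: y')) - fr xs <=
    potential hmin xs eta y - potential hmin xs eta' y' - u (x - xs) +
    p^-1 * (noise_weight * dual_norm u `^ p) * eta `^ (p - 1).
Proof.
move=> x y' Hmin Xxs /andP[e'0 e'e] Le; rewrite /potential -/x.
set x' := Q (eta' *: y').
have e0 : 0 < eta := lt_le_trans e'0 e'e.
have p0 : 0 < p by case/andP: p12 => p1 _; exact: lt_trans p1.
have Xx : X x := mirror_map_in _.
have Xx' : X x' := mirror_map_in _.
have sx : subdiff h x (eta *: y) := mirror_subdiff _.
have Fge := subdiff_strong _ _ _ sx Xx'.
have smooth := relatively_smooth_subdiff _ _ _ sx Xx'.
have Dfx : dom_subdiff f x by apply: domhf; exists (eta *: y).
have conv := subdiff_le _ _ _ _ _ ffin Xx Xxs (self.1 _ Dfx).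
have noise : (- u (x' - x) : R) <= dual_norm u * `|x' - x|.
  by rewrite (le_trans (ler_norm _))// normrN norm_le_dual_norm.
have young := noise_vs_quadratic p K eta (dual_norm u) `|x' - x| (diameter X)
  p12 K0 e0 (dual_norm_ge0 u).
have dD : 0 <= `|x' - x| <= diameter X by rewrite normr_ge0 le_diameter.
have {}noise := le_trans noise (young dD).
rewrite -/noise_weight in noise.
have hx' := Hmin _ Xx'.
(* A smaller step size only increases the regularization penalty at [x'], because [hr x' - hmin] is
   nonnegative; this is why the potential subtracts [hmin]. *)
have scale : (hr x' - hmin) / eta <= (hr x' - hmin) / eta'.
  by rewrite ler_wpM2l ?subr_ge0// lef_pV2.
(* The step-size condition gives [1/eta - L >= (p-1)/(p eta)], and strong convexity bounds the
   coupling below: this is the share left for the noise. *)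
have coef : (p - 1) / p / eta * (K / 2 * `|x' - x| ^+ 2) <=
    (eta^-1 - L) * (hr x' - hr x - (eta *: y) (x' - x)).
  apply: ler_pM.
  - by rewrite !divr_ge0 ?(ltW p0) ?(ltW e0)// subr_ge0; case/andP: p12 => /ltW.
  - by rewrite mulr_ge0 ?exprn_ge0// divr_ge0// ltW.
  - rewrite (_ : _ / _ = eta^-1 - (p * eta)^-1) ?lerD2l ?lerN2//.
    by field; rewrite !gt_eqF.
  - by move: Fge; lra.
have yE : (eta *: y) (x' - x) = eta * (y x' - y x) :> R.
  by rewrite scale_lfunE linearB.
have y'E v : y' v = y v - (gradf x v + u v) :> R.
  by rewrite /y' add_lfunE opp_lfunE add_lfunE.
have lB (z : V') v w : z (v - w) = z v - z w :> R by rewrite linearB.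
move: smooth conv scale coef noise; rewrite !yE !y'E !lB /=.
move: (_ * (K / 2 * _)) (p^-1 * _ * _) => q r.
(* Once evaluations are abstracted to scalars and the product by [eta^-1 - L] is expanded, the claim
   is linear. *)
have G (a b c a' b' m gx gx' gs ux ux' us yx yx' ys s : R) :
  a <= b + (gx' - gx) + L * (a' - b' - eta * (yx' - yx)) ->
  b + (gs - gx) <= c ->
  (a' - m) / eta <= s ->
  q <= (eta^-1 - L) * (a' - b' - eta * (yx' - yx)) ->
  - (ux' - ux) <= q + r ->
  a - c <= yx - (b' - m) / eta - ys -
    ((yx' - (gx' + ux')) - s - (ys - (gs + us))) - (ux - us) + r.
  have -> : (eta^-1 - L) * (a' - b' - eta * (yx' - yx)) = (a' - m) / eta -
    (b' - m) / eta - (yx' - yx) - L * (a' - b' - eta * (yx' - yx)).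
    by field; rewrite gt_eqF.
  lra.
exact: G.
Qed.

(** Telescoping. [m] is the minimum of [h], attained at [Q 0], so the potential starts at [0];
    maximality tested at [xs] bounds the last potential below by [- (hr xs - m) / eta n.+1]. *)
Lemma regret_bound (xs : V) (eta : nat -> R) (y u : nat -> V') (n : nat) :
  let x t := Q (eta t *: y t) in
  X xs -> y 1%N = 0 ->
  (forall t, (0 < t)%N -> y t.+1 = y t - (gradf (x t) + u t)) ->
  (forall t, (0 < t)%N -> 0 < eta t.+1 <= eta t) ->
  (forall t, (0 < t)%N -> L <= (p * eta t)^-1) ->
  \sum_(1 <= t < n.+1) (fr (x t.+1) - fr xs) <=
    range_width X h / eta n.+1 +
    \sum_(1 <= t < n.+1) (- u t (x t - xs) +
      p^-1 * (noise_weight * dual_norm (u t) `^ p) * eta t `^ (p - 1)).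
Proof.
move=> x Xxs y1 yS etaS etaL.
pose m := hr (Q 0).
have Hm v : X v -> m <= hr v.
  move=> Xv; have [_ /(_ v Xv)] := mirror_mapP 0.
  by rewrite !zero_lfunE !sub0r lerN2.
have e0 t : 0 < eta t.+1.
  by case: t => [|t]; [have := etaS 1%N isT|have := etaS t.+1 isT] => /andP[]//;
     apply: lt_le_trans.
have step t : (0 < t)%N -> fr (x t.+1) - fr xs <=
    potential m xs (eta t) (y t) - potential m xs (eta t.+1) (y t.+1) +
    (- u t (x t - xs) +
     p^-1 * (noise_weight * dual_norm (u t) `^ p) * eta t `^ (p - 1)).
  move=> t0; rewrite addrA /x yS//.
  exact: potential_descent (Hm) Xxs (etaS t t0) (etaL t t0).
have tele : \sum_(1 <= t < n.+1) (fr (x t.+1) - fr xs) <=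
    potential m xs (eta 1%N) (y 1%N) - potential m xs (eta n.+1) (y n.+1) +
    \sum_(1 <= t < n.+1) (- u t (x t - xs) +
      p^-1 * (noise_weight * dual_norm (u t) `^ p) * eta t `^ (p - 1)).
  elim: n => [|k IH]; first by rewrite !big_nil subrr add0r.
  rewrite !(big_nat_recr k.+1)//=; apply: (le_trans (lerD IH (step k.+1 isT))).
  by rewrite addrACA [X in X + _ <= _]addrA subrK.
apply: (le_trans tele); rewrite lerD2r.
have -> : potential m xs (eta 1%N) (y 1%N) = 0.
  by rewrite /potential y1 scaler0 !zero_lfunE /m subrr mul0r !subrr.
rewrite sub0r /potential.
have [_ /(_ xs Xxs)] := mirror_mapP (eta n.+1 *: y n.+1).
rewrite !scale_lfunE => H.
have W := range_width_le xs (Q 0) Xxs (mirror_map_in 0).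
rewrite -/m in W.
apply: (@le_trans _ _ ((hr xs - m) / eta n.+1)); last first.
  by rewrite ler_pM2r ?invr_gt0.
rewrite ler_pdivlMr//.
have G (a b c d : R) : eta n.+1 * a - b <= eta n.+1 * c - d ->
  - (c - (d - m) / eta n.+1 - a) * eta n.+1 <= b - m.
  rewrite (_ : - _ * _ = d - m - eta n.+1 * c + eta n.+1 * a); first lra.
  by field; rewrite gt_eqF.
exact: G.
Qed.

Lemma gradient_eval_continuous v :
  {within dom_subdiff f, continuous (fun z => gradf z v : R)}.
Proof.
apply/subspace_continuousP => x Dx.
have /cvgrPdist_lt H := self.2 x Dx.
apply/(@cvgrPdist_lt _ R^o) => eps eps0.
have v1 : 0 < `|v| + 1 by rewrite ltr_wpDl.
have := H (eps / (`|v| + 1)) (divr_gt0 eps0 v1).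
rewrite !near_withinE; apply: filterS => z Hz Dz.
have := Hz Dz; rewrite sub0r normrN ger0_norm ?dual_norm_ge0// => {}Hz.
rewrite distrC (_ : (_ - _ : R) = (gradf z - gradf x) v); last first.
  by rewrite add_lfunE opp_lfunE.
apply: (le_lt_trans (norm_le_dual_norm _ _)).
apply: (@le_lt_trans _ _ (dual_norm (gradf z - gradf x) * (`|v| + 1))).
  by rewrite ler_wpM2l ?dual_norm_ge0// lerDl.
by rewrite -ltr_pdivlMr.
Qed.

(** * Adaptedness of the iterates and moments of the noise *)

Context {dS} {S : measurableType dS} {mu : probability S R}.
Variables (U : V -> S -> V') (sigma : R).
Hypotheses (noise : stochastic_noise f mu U p sigma).

(** Measurability of [U] is given for the trace on the domain of [subdiff f]; it becomes plain
    measurability after composition with a map that stays in that domain. *)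
Lemma noise_measurable {d} {T : measurableType d} (x : T -> V) (s : T -> S) v :
  measurable_fun setT (x : T -> borel_type V) -> measurable_fun setT s ->
  (forall w, dom_subdiff f (x w)) ->
  measurable_fun setT (fun w => U (x w) (s w) v : R).
Proof.
move=> mx ms Dx; have [/(_ v) mU _ _] := noise.
move=> _ B mB; rewrite setTI; have [C mC CE] := mU B mB.
pose xs w : borel_type V * S := (x w, s w).
have mxs : measurable_fun setT xs by apply/measurable_fun_pairP.
rewrite (_ : _ @^-1` B = xs @^-1` C); first by rewrite -[X in measurable X]setTI; exact: mxs.
have H w : C (xs w) <-> B (U (x w) (s w) v).
  have /seteqP[H1 H2] := CE; split => Hw.
    by have [] := H2 (xs w) (conj (Dx w) Hw).
  by have [] := H1 (xs w) (conj (Dx w) Hw).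
by apply/seteqP; split => w /= /H.
Qed.

Context {dO} {Omega : measurableType dO} {P : probability Omega R}.
Variables (omega : nat -> {RV P >-> S}) (eta : nat -> R).
Hypothesis iid : iid_seeds mu omega.
Variables (x : nat -> Omega -> V) (y : nat -> Omega -> V').
Hypothesis sda : SDA X h gradf U omega eta 0 x y.
Local Notation past := (past omega).

Lemma iterate_mirror t w : (0 < t)%N -> x t w = Q (eta t *: y t w).
Proof. by move=> t0; have [_ /(_ t t0)] := sda w. Qed.

Lemma iterate_in t w : (0 < t)%N -> X (x t w).
Proof. by move=> t0; rewrite iterate_mirror//; exact: mirror_map_in. Qed.

Lemma iterate_dom t w : (0 < t)%N -> dom_subdiff f (x t w).
Proof.
move=> t0; apply: domhf; rewrite iterate_mirror//.
by exists (eta t *: y t w); exact: mirror_subdiff.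
Qed.

(** Adaptedness, by induction: [x t] is a continuous function of the coordinates of [y t], and the
    update to [y t.+1] uses only [x t], [y t] and [omega t], all measurable for [past t.+1]. *)
Lemma iterate_measurable t : (0 < t)%N ->
  measurable_fun setT (x t : past t -> borel_type V) /\
  forall v, measurable_fun setT (fun w : past t => y t w v : R).
Proof.
have mirror_meas s : (0 < s)%N ->
    (forall v, measurable_fun setT (fun w : past s => y s w v : R)) ->
    measurable_fun setT (x s : past s -> borel_type V).
  move=> s0 my; apply: measurable_borel_opens => B oB.
  rewrite (_ : x s @^-1` B = (Q \o (fun w : past s => eta s *: y s w)) @^-1` B).
    apply: measurable_form_preimage => // [|v]; first exact: mirror_continuous.
    under eq_fun do rewrite scale_lfunE.
    exact: (measurable_funM (measurable_cst (eta s)) (my v)).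
  by apply/seteqP; split => w /=; rewrite iterate_mirror.
case: t => // t _; elim: t => [|t [mx my]].
  have my v : measurable_fun setT (fun w : past 1 => y 1%N w v : R).
    rewrite (_ : (fun _ => _) = cst 0); first exact: measurable_cst.
    by apply/funext => w; have [-> _ _] := sda w; rewrite zero_lfunE.
  by split => //; exact: mirror_meas.
have liftS d (T : measurableType d) (g : Omega -> T) :
    measurable_fun setT (g : past t.+1 -> T) -> measurable_fun setT (g : past t.+2 -> T).
  by move=> mg; exact: (measurableT_comp mg (@pastS_id_measurable _ _ _ _ _ _ omega t.+1)).
have my' v : measurable_fun setT (fun w : past t.+2 => y t.+2 w v : R).
  rewrite (_ : (fun _ => _) = (fun w => (y t.+1 w v : R) -
      ((gradf (x t.+1 w) v : R) + (U (x t.+1 w) (omega t.+1 w) v : R)))); last first.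
    apply/funext => w; have [_ _ ->//] := sda w.
    by rewrite add_lfunE opp_lfunE add_lfunE.
  apply: measurable_funB; first exact: (liftS _ _ _ (my v)).
  apply: measurable_funD.
    apply: (@measurable_continuous_within R V _ (past t.+2) _ _ (x t.+1)
      (gradient_eval_continuous v)).
      by move=> w; exact: iterate_dom.
    exact: (liftS _ _ _ mx).
  apply: noise_measurable; first exact: (liftS _ _ _ mx).
    exact: seed_past_measurable.
  by move=> w; exact: iterate_dom.
by split => //; exact: mirror_meas.
Qed.

(** The whole past as one random variable: the identity into a coarser measurable space, so that
    freezing it freezes [x t]. *)
Let past_id t : {RV P >-> past t} :=
  HB.pack (id : Omega -> past t)
    (isMeasurableFun.Build _ _ _ _ _ (@past_id_measurable _ _ _ _ _ _ omega t)).

Let past_freeze t : (0 < t)%N -> forall A B, measurable A -> measurable B ->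
  (P (past_id t @^-1` A `&` omega t @^-1` B) = P (past_id t @^-1` A) * mu B)%E.
Proof. by move=> t0 A B mA mB; exact: past_indep. Qed.

Lemma sample_noise_measurable t v : (0 < t)%N ->
  measurable_fun setT (fun z : past t * S => U (x t z.1) z.2 v : R).
Proof.
move=> t0; apply: noise_measurable => [||w]; last exact: iterate_dom.
  have [mx _] := iterate_measurable t t0.
  exact: (measurableT_comp mx measurable_fst).
exact: measurable_snd.
Qed.

Lemma iterate_noise_measurable t v : (0 < t)%N ->
  measurable_fun setT (fun w => U (x t w) (omega t w) v : R).
Proof.
move=> t0; apply: noise_measurable => [||w]; last exact: iterate_dom.
  have [mx _] := iterate_measurable t t0.
  exact: (measurableT_comp mx (@past_id_measurable _ _ _ _ _ _ omega t)).
exact: measurable_funPT.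
Qed.

Lemma iterate_borel t : (0 < t)%N ->
  measurable_fun setT (x t : Omega -> borel_type V).
Proof.
move=> t0; have [mx _] := iterate_measurable t t0.
exact: (measurableT_comp mx (@past_id_measurable _ _ _ _ _ _ omega t)).
Qed.

Lemma powR_dual_norm_measurable {d} {T : measurableType d} (Y : T -> V') :
  (forall v, measurable_fun setT (fun w => Y w v : R)) ->
  measurable_fun setT (fun w => dual_norm (Y w) `^ p).
Proof.
move=> mY; have mp : measurable_fun setT (fun a : R => a `^ p) by exact: measurable_powR.
apply: (measurableT_comp mp); exact: measurable_dual_norm.
Qed.

Lemma noise_moment t : (0 < t)%N ->
  (\int[P]_w (dual_norm (U (x t w) (omega t w)) `^ p)%:E <= (sigma `^ p)%:E)%E.
Proof.
move=> t0.
pose g (z : past t * S) := (dual_norm (U (x t z.1) z.2) `^ p)%:E.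
apply: (@ge0_integral_freeze_le _ _ _ P _ _ mu _ _ (past_id t) (omega t)
  (past_freeze t t0) g).
- apply/measurable_EFinP; apply: powR_dual_norm_measurable => v.
  exact: sample_noise_measurable.
- by move=> z; rewrite lee_fin powR_ge0.
- move=> w; have [_ _ /(_ (x t w) (iterate_dom t w t0))] := noise.
  by rewrite unlock.
Qed.

Lemma noise_moment_integrable t : (0 < t)%N ->
  P.-integrable setT (fun w => (dual_norm (U (x t w) (omega t w)) `^ p)%:E).
Proof.
move=> t0; apply/integrableP; split.
  apply/measurable_EFinP; apply: powR_dual_norm_measurable => v.
  exact: iterate_noise_measurable.
under eq_integral do rewrite gee0_abs ?lee_fin ?powR_ge0//.
exact: le_lt_trans (noise_moment t t0) (ltry _).
Qed.

Lemma noise_term_integrable t xs : (0 < t)%N -> X xs ->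
  P.-integrable setT (fun w => (U (x t w) (omega t w) (x t w - xs) : R)%:E).
Proof.
move=> t0 Xxs; have /andP[p1 _] := p12.
have D0 : 0 <= diameter X by rewrite (le_trans _ (le_diameter _ _ _ cX Xxs Xxs)).
(* As [a <= 1 + a^p] for [a >= 0], the [p]-th moment dominates the dual norm; the other factor is at
   most the diameter. *)
apply: (@le_integrable _ _ _ _ _ measurableT _
  (fun w => ((1 + dual_norm (U (x t w) (omega t w)) `^ p) * diameter X)%:E)).
- apply/measurable_EFinP; apply: measurable_form_apply.
    by move=> v; exact: iterate_noise_measurable.
  apply: measurable_borel_coord => i.
  under eq_fun do rewrite linearB/=.
  apply: measurable_funB; last exact: measurable_cst.
  exact/measurable_coord/iterate_borel.
- move=> w _; rewrite !abse_EFin lee_fin.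
  have d0 := dual_norm_ge0 (U (x t w) (omega t w)).
  rewrite [leRHS]ger0_norm ?mulr_ge0 ?addr_ge0 ?powR_ge0//.
  apply: (le_trans (norm_le_dual_norm _ _)); apply: ler_pM => //.
    have [a1|a1] := leP (dual_norm (U (x t w) (omega t w))) 1.
      by rewrite (le_trans a1)// lerDl powR_ge0.
    by apply: (le_trans (le1r_powR (ltW a1) (ltW p1))); rewrite lerDr.
  by apply: le_diameter => //; exact: iterate_in.
- under eq_fun do rewrite EFinM EFinD.
  apply: integrableZr => //; apply: integrableD => //; last exact: noise_moment_integrable.
  exact: finite_measure_integrable_cst.
Qed.

(** Once the past is frozen, [x t - xs] is a fixed vector, at which the noise has mean zero. *)
Lemma noise_term_mean0 t xs : (0 < t)%N -> X xs ->
  (\int[P]_w (U (x t w) (omega t w) (x t w - xs) : R)%:E = 0)%E.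
Proof.
move=> t0 Xxs.
pose g (z : past t * S) := (U (x t z.1) z.2 (x t z.1 - xs) : R)%:E.
apply: (@integral_freeze_eq0 _ _ _ P _ _ mu _ _ (past_id t) (omega t)
  (past_freeze t t0) g).
- apply/measurable_EFinP; apply: measurable_form_apply.
    by move=> v; exact: sample_noise_measurable.
  apply: measurable_borel_coord => i.
  under eq_fun do rewrite linearB/=.
  apply: measurable_funB; last exact: measurable_cst.
  have [mx _] := iterate_measurable t t0.
  apply: measurable_coord; exact: (measurableT_comp mx measurable_fst).
- exact: noise_term_integrable.
- move=> w; have [_ /(_ (x t w) (x t w - xs) (iterate_dom t w t0)) + _] := noise.
  by rewrite unlock.
Qed.

(** * Averaging and expectation *)

Lemma time_average_jensen (z : nat -> V) n : (forall t, (0 < t)%N -> X (z t)) ->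
  let avg := n.+1%:R^-1 *: \sum_(1 <= t < n.+2) z t in
  X avg /\ fr avg <= n.+1%:R^-1 * \sum_(1 <= t < n.+2) fr (z t).
Proof.
move=> Xz; elim: n => [|n [IHX IHf]] /=.
  by rewrite !big_nat1 invr1 scale1r mul1r; split => //; exact: Xz.
(* The new average puts weight [a] on the previous average and [1 - a] on the new point. *)
set a : R := n.+1%:R / n.+2%:R.
have a01 : 0 < a < 1 by rewrite divr_gt0//= ltr_pdivrMr// mul1r ltr_nat.
have aE : 1 - a = n.+2%:R^-1.
  have b0 : (n.+2%:R : R) != 0 by rewrite pnatr_eq0.
  by apply: (mulfI b0); rewrite mulrBr mulrCA !divff// !mulr1 -natrB// subSn// subnn.
have aM : a * n.+1%:R^-1 = n.+2%:R^-1 by rewrite /a mulrAC divff// mul1r.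
have avgE : n.+2%:R^-1 *: (\sum_(1 <= t < n.+3) z t) =
    a *: (n.+1%:R^-1 *: \sum_(1 <= t < n.+2) z t) + (1 - a) *: z n.+2.
  by rewrite scalerA aM aE -scalerDr -big_nat_recr.
have Xc := dom_convex _ _ a IHX (Xz n.+2 isT) a01; rewrite avgE; split => //.
rewrite -lee_fin fineK ?ffin//.
apply: (le_trans (convex_ext_fine _ _ _ _ _ ffin cf IHX (Xz n.+2 isT) a01)).
rewrite lee_fin aE (big_nat_recr n.+2)//= mulrDr lerD2r -aM -[leRHS]mulrA.
by rewrite ler_wpM2l//; case/andP: a01 => /ltW.
Qed.

Lemma noise_sum_integral (xs : V) n : X xs ->
  let Z t w := - (U (x t w) (omega t w) (x t w - xs) : R) +
    p^-1 * (noise_weight * dual_norm (U (x t w) (omega t w)) `^ p) *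
      eta t `^ (p - 1) in
  P.-integrable setT (fun w => (\sum_(1 <= t < n.+1) Z t w)%:E) /\
  (\int[P]_w (\sum_(1 <= t < n.+1) Z t w)%:E <=
    (\sum_(1 <= t < n.+1)
      p^-1 * (noise_weight * sigma `^ p) * eta t `^ (p - 1))%:E)%E.
Proof.
move=> Xxs Z; have p0 : 0 < p by case/andP: p12 => p1 _; exact: lt_trans p1.
have iZ t : (0 < t)%N -> P.-integrable setT (fun w => (Z t w)%:E) /\
    (\int[P]_w (Z t w)%:E <=
      (p^-1 * (noise_weight * sigma `^ p) * eta t `^ (p - 1))%:E)%E.
  move=> t0.
  pose c := p^-1 * noise_weight * eta t `^ (p - 1).
  have c0 : 0 <= c.
    by rewrite !mulr_ge0 ?powR_ge0// invr_ge0 ltW.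
  have ZE w : (Z t w)%:E = (- (U (x t w) (omega t w) (x t w - xs) : R)%:E +
      c%:E * (dual_norm (U (x t w) (omega t w)) `^ p)%:E)%E.
    by rewrite -EFinN -EFinM -EFinD /Z /c; congr (_ + _)%:E; ring.
  have i1 := noise_term_integrable t xs t0 Xxs.
  have i2 := noise_moment_integrable t t0.
  rewrite (funext ZE).
  split; first by apply: integrableD => //; [exact: integrableN|exact: integrableZl].
  rewrite integralD//; [|exact: integrableN|exact: integrableZl].
  rewrite integralN ?integrable_add_def//.
  rewrite noise_term_mean0// oppe0 add0e integralZl//.
  have -> : p^-1 * (noise_weight * sigma `^ p) * eta t `^ (p - 1) = c * sigma `^ p.
    by rewrite /c; ring.
  by rewrite [leRHS]EFinM; apply: lee_wpmul2l; rewrite ?lee_fin// noise_moment.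
elim: n => [|n [IHi IH]].
  under eq_fun do rewrite big_nil.
  by rewrite integral0 big_nil; split => //; exact: integrable0.
have [i1 b1] := iZ n.+1 isT.
under eq_fun do rewrite big_nat_recr//= EFinD.
split; first exact: integrableD.
by rewrite integralD// big_nat_recr//= EFinD leeD.
Qed.

Hypothesis contf : {within X, continuous f}.
Hypothesis etaS : forall t, (0 < t)%N -> 0 < eta t.+1 <= eta t.
Hypothesis etaL : forall t, (0 < t)%N -> L <= (p * eta t)^-1.

(** The regret bound covers the iterates [2] to [n + 1]; the first is split off and contributes
    [fr x1 - fr xs], so [n] steps control an average of [n + 1] points. *)
Lemma time_average_bound (xs : V) n w : X xs ->
  fr (time_average x n.+1 w) <= fr xs + n.+1%:R^-1 *
    (fr (Q (eta 1%N *: 0)) - fr xs + range_width X h / eta n.+1 +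
     \sum_(1 <= t < n.+1) (- (U (x t w) (omega t w) (x t w - xs) : R) +
       p^-1 * (noise_weight * dual_norm (U (x t w) (omega t w)) `^ p) *
         eta t `^ (p - 1))).
Proof.
move=> Xxs; have [y1 _ yS] := sda w.
have xE t : (0 < t)%N -> Q (eta t *: y t w) = x t w.
  by move=> t0; rewrite iterate_mirror.
have := regret_bound xs eta (fun t => y t w) (fun t => U (x t w) (omega t w)) n Xxs y1.
have yS' t : (0 < t)%N -> y t.+1 w =
    y t w - (gradf (Q (eta t *: y t w)) + U (x t w) (omega t w)).
  by move=> t0; rewrite xE// yS.
move=> /(_ yS' etaS etaL).
rewrite (eq_big_nat _ _ (F2 := fun t => fr (x t.+1 w) - fr xs)); last first.
  by move=> t /andP[t0 _]; rewrite xE.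
rewrite [X in _ <= _ + X -> _](eq_big_nat _ _ (F2 := fun t =>
    - (U (x t w) (omega t w) (x t w - xs) : R) +
    p^-1 * (noise_weight * dual_norm (U (x t w) (omega t w)) `^ p) *
      eta t `^ (p - 1))); last first.
  by move=> t /andP[t0 _]; rewrite xE.
set Z := (X in _ <= _ + X -> _) => reg.
have [_] := time_average_jensen (fun t => x t w) n (fun t => iterate_in t w).
move=> /le_trans; apply.
have sumE : \sum_(1 <= t < n.+2) fr (x t w) = n.+1%:R * fr xs +
    (fr (x 1%N w) - fr xs + \sum_(1 <= t < n.+1) (fr (x t.+1 w) - fr xs)).
  rewrite sumrB sumr_const_nat subn1 /= big_nat_recl//= big_add1.
  rewrite -[n.+1%:R]natr1 mulrDl mul1r [n%:R * _]mulr_natl.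
  by ring.
rewrite sumE mulrDr mulKf ?pnatr_eq0// lerD2l ler_pM2l ?invr_gt0 ?ltr0n//.
by rewrite -(xE 1%N)// y1 -[leRHS]addrA lerD2l.
Qed.

Lemma time_average_expectation (xs : V) n : X xs ->
  (\int[P]_w f (time_average x n.+1 w) <= (fr xs + n.+1%:R^-1 *
    (fr (Q (eta 1%N *: 0)) - fr xs + range_width X h / eta n.+1 +
     \sum_(1 <= t < n.+1)
       p^-1 * (noise_weight * sigma `^ p) * eta t `^ (p - 1)))%:E)%E.
Proof.
move=> Xxs.
have Xavg w : X (time_average x n.+1 w).
  by have [] := time_average_jensen (fun t => x t w) n (fun t => iterate_in t w).
have mavg : measurable_fun setT (time_average x n.+1 : Omega -> borel_type V).
  apply: measurable_borel_coord => i.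
  rewrite (_ : (fun _ => _) = (fun w => n.+1%:R^-1 *
      \sum_(0 <= t < n.+1) coord (vbasis {:V}) i (x t.+1 w))); last first.
    by apply/funext => w; rewrite linearZ/= linear_sum big_add1.
  apply: measurable_funM; first exact: measurable_cst.
  by apply: measurable_sum => t; apply: measurable_coord; exact: iterate_borel.
have mfr : measurable_fun setT (fun w => fr (time_average x n.+1 w)).
  exact: (@measurable_continuous_within R V _ Omega X _ _
    (fine_continuous_within _ _ ffin contf) Xavg mavg).
have [iS bS] := noise_sum_integral xs n Xxs.
pose A := fr xs + n.+1%:R^-1 *
    (fr (Q (eta 1%N *: 0)) - fr xs + range_width X h / eta n.+1).
have ifr : P.-integrable setT (fun w => (fr (time_average x n.+1 w))%:E).
  (* [f] is bounded on the compact [X], hence integrable along the averages. *)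
  have /compact_bounded[M [_ HM]] : compact (fr @` X).
    exact: continuous_compact (fine_continuous_within _ _ ffin contf) cX.
  apply: (@le_integrable _ _ _ _ _ measurableT _ (fun=> (M + 1)%:E)).
  - exact/measurable_EFinP.
  - move=> w _; rewrite !abse_EFin lee_fin (le_trans _ (ler_norm _))//.
    by apply: HM; rewrite ?ltrDl//; exists (time_average x n.+1 w).
  - exact: finite_measure_integrable_cst.
under eq_integral => w _ do rewrite -(fineK (ffin _ (Xavg w))).
pose Z w := \sum_(1 <= t < n.+1) (- (U (x t w) (omega t w) (x t w - xs) : R) +
       p^-1 * (noise_weight * dual_norm (U (x t w) (omega t w)) `^ p) *
         eta t `^ (p - 1)).
have iA : P.-integrable setT (fun=> A%:E) by exact: finite_measure_integrable_cst.
have iZ : P.-integrable setT (fun w => (n.+1%:R^-1)%:E * (Z w)%:E)%E.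
  exact: integrableZl.
apply: (@le_trans _ _ (\int[P]_w (A%:E + (n.+1%:R^-1)%:E * (Z w)%:E))%E).
  apply: le_integral => //; first exact: integrableD.
  move=> w _; rewrite -EFinM -EFinD lee_fin.
  apply: (le_trans (time_average_bound xs n w Xxs)).
  by rewrite mulrDr addrA.
rewrite integralD// integral_cst//= [P _]probability_setT mule1 integralZl//.
rewrite mulrDr addrA [leRHS]EFinD -/A; apply: leeD => //.
by rewrite [leRHS]EFinM; apply: lee_wpmul2l => //; rewrite lee_fin.
Qed.

End mirror_descent.

(** * Rates *)

Section rates.
Context {R : realType}.
Variables p beta : R.
Hypotheses (p1 : 1 < p) (beta0 : 0 < beta).
Let eta (t : nat) : R := beta / t%:R `^ (1 / p).

Let p0 : 0 < p. Proof. exact: lt_trans p1. Qed.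

Let powRT (T : R) : 0 < T -> T = T `^ (1 / p) * T `^ ((p - 1) / p).
Proof.
move=> T0; rewrite -powRD ?(gt_eqF T0) ?implybT//.
rewrite (_ : _ + _ = 1) ?powRr1 ?(ltW T0)//.
by field; rewrite gt_eqF.
Qed.

Lemma step_size_gt0 t : (0 < t)%N -> 0 < eta t.
Proof. by move=> t0; rewrite divr_gt0// powR_gt0// ltr0n. Qed.

Lemma step_size_decreasing t : (0 < t)%N -> 0 < eta t.+1 <= eta t.
Proof.
move=> t0; rewrite step_size_gt0//= ler_pM2l// lef_pV2 ?posrE ?powR_gt0 ?ltr0n//.
by rewrite ge0_ler_powR ?nnegrE ?ler0n ?ler_nat// divr_ge0// ltW.
Qed.

Lemma step_size_le (L : R) t : 0 < L -> beta <= 1 / (p * L) -> (0 < t)%N ->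
  L <= (p * eta t)^-1.
Proof.
move=> L0 bL t0; have e0 := step_size_gt0 t t0.
have eb : eta t <= beta.
  rewrite ler_pdivrMr ?powR_gt0 ?ltr0n// ler_peMr ?(ltW beta0)//.
  by rewrite -[leLHS](powRr0 (t%:R)) ler_powR ?ler1n// divr_ge0// ltW.
have := le_trans eb bL; rewrite ler_pdivlMr ?mulr_gt0// => H.
rewrite -[_^-1]mul1r ler_pdivlMr ?(mulr_gt0 p0 e0)//.
by rewrite mulrC [p * _]mulrC -mulrA.
Qed.

(** [eta^(p-1)] is [beta^(p-1) t^(1/p - 1)], and these powers of [t] sum to at most [p T^(1/p)]: the
    factor [p] cancels the [p^-1] of Young's inequality, and [T = T^(1/p) T^((p-1)/p)] gives the
    rate. *)
Lemma dual_averaging_rate (H W : R) n : 0 <= W ->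
  n.+1%:R^-1 * (H / eta n.+1 + \sum_(1 <= t < n.+1) p^-1 * W * eta t `^ (p - 1)) <=
  (H + beta `^ p * W) / (beta * n.+1%:R `^ ((p - 1) / p)).
Proof.
move=> W0; set T : R := n.+1%:R; have T0 : 0 < T by rewrite ltr0n.
have r01 : 0 < 1 / p < 1 by rewrite divr_gt0//= ltr_pdivrMr// mul1r.
have etaE t : eta t `^ (p - 1) = beta `^ (p - 1) * t%:R `^ (1 / p - 1).
  rewrite /eta -powRN powRM ?powR_ge0 ?(ltW beta0)// -powRrM.
  have -> : - (1 / p) * (p - 1) = 1 / p - 1 by field; rewrite gt_eqF.
  by [].
under eq_bigr do rewrite etaE.
rewrite -mulr_sumr -mulr_sumr.
have sum_le : \sum_(1 <= t < n.+1) (t%:R : R) `^ (1 / p - 1) <= p * T `^ (1 / p).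
  apply: (le_trans (sum_powRB1_le _ n r01)); rewrite div1r invrK.
  rewrite ler_wpM2l ?(ltW p0)// ge0_ler_powR ?nnegrE ?ler0n ?ler_nat//.
  by rewrite invr_ge0 ltW.
have c0 : 0 <= p^-1 * W * beta `^ (p - 1).
  by rewrite !mulr_ge0 ?powR_ge0// invr_ge0 ltW.
have sumW := ler_wpM2l c0 sum_le.
have TE := powRT T T0; set a := T `^ (1 / p) in sumW TE *.
set b := T `^ _ in TE *.
have a0 : 0 < a by rewrite powR_gt0.
have b0 : 0 < b by rewrite powR_gt0.
apply: (@le_trans _ _ (T^-1 * (H / eta n.+1 + p^-1 * W * beta `^ (p - 1) * (p * a)))).
  by rewrite ler_pM2l ?invr_gt0// lerD2l [leLHS]mulrA.
rewrite -(@mulr_powRB1 _ beta p) ?(ltW beta0)// /eta -/T -/a TE.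
rewrite le_eqVlt; apply/orP; left; apply/eqP.
by field; rewrite !gt_eqF.
Qed.

(** This [beta] makes [(beta V)^p = H / (p - 1)], so the numerator is [p H / (p - 1)]. *)
Lemma optimal_rate (H V T : R) : 0 <= H -> 0 <= V -> 0 < T ->
  beta = (H / (p - 1)) `^ (1 / p) / V ->
  (H + beta `^ p * V `^ p) / (beta * T `^ ((p - 1) / p)) =
  p * (H / (p - 1)) `^ ((p - 1) / p) * V / T `^ ((p - 1) / p).
Proof.
move=> H0 V0 T0 bE; set a := H / (p - 1) in bE *.
have pB : 0 < p - 1 by rewrite subr_gt0.
(* By the convention [0^-1 = 0], [V = 0] would force [beta = 0]. *)
have Vn0 : V != 0.
  by apply/eqP => V00; move: beta0; rewrite bE V00 invr0 mulr0 ltxx.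
have a_ge0 : 0 <= a by rewrite divr_ge0// ltW.
have a0 : 0 < a.
  rewrite lt_neqAle a_ge0 andbT eq_sym; apply/eqP => a00.
  move: beta0; rewrite bE a00 powR0 ?mul0r ?ltxx//.
  by rewrite gt_eqF// divr_gt0.
rewrite -powRM ?(ltW beta0)//.
have -> : beta * V = a `^ (1 / p) by rewrite bE divfK.
rewrite -powRrM div1r mulVf ?gt_eqF// powRr1//.
have HE : H = a * (p - 1) by rewrite /a divfK ?gt_eqF.
have aE := powRT a a0.
rewrite HE (_ : a * (p - 1) + a = p * a); last by ring.
rewrite bE {1}aE; have := powR_gt0 (1 / p) a0.
have := powR_gt0 ((p - 1) / p) T0.
move: (a `^ (1 / p)) (T `^ _) => v w w0 v0.
by field; rewrite Vn0 (gt_eqF w0) (gt_eqF v0).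
Qed.

End rates.

(** * Assembly of the expectation bound and the rates *)

Local Open Scope ereal_scope.

Theorem theorem5 (R : realType) (V : normedVectType R)
  (X : set V) (f h : V -> \bar R) (gradf gradh : V -> 'Hom(V, R^o))
  (K L p sigma beta : R)
  (dS : measure_display) (S : measurableType dS) (mu : probability S R)
  (U : V -> S -> 'Hom(V, R^o))
  (dO : measure_display) (Omega : measurableType dO) (P : probability Omega R)
  (omega : nat -> {RV P >-> S})
  (x : nat -> Omega -> V) (y : nat -> Omega -> 'Hom(V, R^o)) :
  X !=set0 -> compact X -> convex_set X ->
  convex_ext f -> (forall z, X z -> f z \is a fin_num) ->
  {within X, continuous f} -> continuous_selection f gradf ->
  convex_ext h -> [set z | h z < +oo] = X ->
  {within X, continuous h} -> continuous_selection h gradh ->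
  (0 < K)%R -> strongly_convex h gradh K X ->
  dom_subdiff h `<=` dom_subdiff f ->
  (0 < L)%R -> relatively_smooth f gradf h gradh L X ->
  (1 < p <= 2)%R -> (0 <= sigma)%R ->
  stochastic_noise f mu U p sigma -> iid_seeds mu omega ->
  (0 < beta)%R -> (beta <= 1 / (p * L))%R ->
  let eta := fun t : nat => (beta / t%:R `^ (1 / p))%R in
  SDA X h gradf U omega eta 0%R x y ->
  let minf := min_over X f in
  let x1 := mirror_map X h (eta 1%N *: 0)%R in
  let H := range_width X h in
  let Vsigma := noise_const X K p sigma in
  (forall T : nat, (0 < T)%N ->
    \int[P]_w f (time_average x T w) <=
      minf + (f x1 - minf) * (T%:R^-1)%:E +
      ((H + beta `^ p * Vsigma `^ p) / (beta * T%:R `^ ((p - 1) / p)))%:E) /\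
  (beta = ((H / (p - 1)) `^ (1 / p) / Vsigma)%R ->
   forall T : nat, (0 < T)%N ->
    \int[P]_w f (time_average x T w) <=
      minf + (f x1 - minf) * (T%:R^-1)%:E +
      (p * (H / (p - 1)) `^ ((p - 1) / p) * Vsigma /
        T%:R `^ ((p - 1) / p))%:E).
Proof.
move=> X0 cX _ cf ffin contf self ch domh conth selh K0 sc domhf L0 rs p12 _.
move=> noise iid beta0 betaL eta sda minf x1 H Vsigma.
have /andP[p1 _] := p12; have p0 : (0 < p)%R := lt_trans ltr01 p1.
(* The comparison point of the regret is a minimizer of [f], which exists by compactness. *)
have [xs xsX Hxs] := compact_EVT_min X0 cX (fine_continuous_within _ _ ffin contf).
have Xxs := set_mem xsX.
have minfE : minf = (fine (f xs))%:E.
  rewrite /minf /min_over fineK ?ffin//; apply/eqP; rewrite eq_le.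
  apply/andP; split; first by apply: ereal_inf_lbound; exists xs.
  apply: le_ereal_inf_tmp => _ [z Xz <-].
  rewrite -(fineK (ffin _ Xxs)) -(fineK (ffin _ Xz)) lee_fin.
  exact/Hxs/mem_set.
have Xx1 : X x1 := mirror_map_in _ _ X0 cX ch domh conth _.
have [u Xu] := X0.
have H0 : (0 <= H)%R.
  by have := range_width_le _ _ X0 cX ch domh conth u u Xu Xu; rewrite subrr.
pose W := (noise_weight X K p * sigma `^ p)%R.
have W0 : (0 <= W)%R by rewrite !mulr_ge0 ?powR_ge0.
have VE : (Vsigma `^ p = W)%R.
  rewrite /Vsigma /noise_const -powRrM mulVf ?gt_eqF// powRr1//.
have main (T : nat) : (0 < T)%N -> \int[P]_w f (time_average x T w) <=
    minf + (f x1 - minf) * (T%:R^-1)%:E +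
    ((H + beta `^ p * W) / (beta * T%:R `^ ((p - 1) / p)))%:E.
  case: T => // n _.
  have := time_average_expectation _ _ _ _ X0 cX ch domh conth selh K0 sc
    _ _ _ _ ffin cf self domhf L0 rs p12 _ _ noise omega eta iid x y sda contf
    (step_size_decreasing _ _ p1 beta0)
    (fun t => step_size_le _ _ p1 beta0 L t L0 betaL) xs n Xxs.
  move=> /le_trans; apply.
  rewrite minfE -(fineK (ffin _ Xx1)) -EFinB -EFinM -!EFinD lee_fin.
  rewrite -addrA mulrDr -[leRHS]addrA lerD2l [X in (_ <= X + _)%R]mulrC lerD2l.
  exact: dual_averaging_rate.
split => [T T0|betaE T T0]; first by rewrite VE; exact: main.
(* For this [beta] the general bound equals the optimized one. *)
have := main T T0.
rewrite -VE optimal_rate ?powR_ge0 ?ltr0n//.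
Qed.
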